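(* Let $X$ be an infinite compact connected metrizable abelian group. Let $\mathfrak p_0$ and $\mathfrak u_0$ be the topologies induced on $c_0(X)$ by the product topology and by the uniform topology of $X^{\mathbb N}$, respectively. Then: (a) $(c_0(X),\mathfrak p_0)^\wedge=(c_0(X),\mathfrak u_0)^\wedge$. (b) $\mathfrak u_0$ is a locally quasi-convex Polish group topology compatible for $(c_0(X),\mathfrak p_0)$. (c) $(c_0(X),\mathfrak p_0)$ is a precompact metrizable group which is not a Mackey group in $\mathrm{LQC}$. Further, it is connected.
   Context: $\mathbb S=\{s\in\mathbb C:|s|=1\}$, $\mathbb S_+=\{s\in\mathbb S:\mathrm{Re}(s)\ge 0\}$. For a topological abelian group $G$, $G^\wedge$ is the group of all continuous homomorphisms $G\to\mathbb S$. Precompact means totally bounded. $X^{\mathbb N}$ is the group of all sequences in $X$; $c_0(X)$ is its subgroup of sequences converging to the neutral element $0$. The uniform topology on $X^{\mathbb N}$ is the group topology having $\{V^{\mathbb N}: V \text{ a neighborhood of } 0 \text{ in } X\}$ as a basis of neighborhoods at the neutral element. A subset $A$ of a topological abelian group $G$ is quasi-convex if for every $x\in G\setminus A$ there is $\chi\in G^\wedge$ with $\chi(A)\subset\mathbb S_+$ and $\chi(x)\notin\mathbb S_+$. $G$ (or its topology) is locally quasi-convex if the neighborhoods of the neutral element have a basis of quasi-convex sets. $\mathrm{LQC}$ is the class of locally quasi-convex Hausdorff topological abelian groups. A group topology $\nu$ on $G$ is compatible for $(G,\mu)$ if $(G,\nu)^\wedge=(G,\mu)^\wedge$. $(G,\mu)$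 is a Mackey group in $\mathrm{LQC}$ if $(G,\mu)\in\mathrm{LQC}$ and every group topology $\nu$ on $G$ that is compatible for $(G,\mu)$ with $(G,\nu)\in\mathrm{LQC}$ satisfies $\nu\le\mu$. *)

(* Defs.v *)
From HB Require Import structures.
From mathcomp Require Import all_boot all_order all_algebra.
From mathcomp Require Import complex.
From mathcomp Require Import all_classical all_reals all_analysis.

Set Implicit Arguments.
Unset Strict Implicit.
Unset Printing Implicit Defensive.

Import Order.TTheory GRing.Theory Num.Theory.
Import numFieldNormedType.Exports.

Local Open Scope classical_set_scope.
Local Open Scope ring_scope.
Local Open Scope complex_scope.

(** Several topologies on one and the same group have to be compared, so a
    topology on [T] is a [nu : Topological T] (the structure that the library
    packs into a [topologicalType]) and [tspace nu] is the space [(T, nu)]. *)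
Definition tspace (T : Type) (nu : Topological T) : topologicalType :=
  Topological.Pack nu.

Definition coarser (T : Type) (nu mu : Topological T) : Prop :=
  forall U : set T, @open (tspace nu) U -> @open (tspace mu) U.

Definition mspace (R : realType) (T : Type) (m : Metric R T) : metricType R :=
  Metric.Pack m.

Definition induces (R : realType) (T : topologicalType) (m : Metric R T) :
    Prop :=
  forall x : T, @nbhs _ (mspace m) x = @nbhs _ T x.

Definition complete_metric (R : realType) (T : Type) (m : Metric R T) : Prop :=
  forall F : set_system (mspace m), ProperFilter F -> cauchy F ->
    exists x : mspace m, F --> x.

Definition metrizable (R : realType) (T : topologicalType) : Prop :=
  exists m : Metric R T, induces m.

Definition separable (T : topologicalType) : Prop :=
  exists2 D : set T, countable D & dense D.

Definition polish (R : realType) (T : topologicalType) : Prop :=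
  separable T /\ exists2 m : Metric R T, induces m & complete_metric m.

Definition circle (R : realType) : set R[i] := [set s | `|s| = 1].
Arguments circle : clear implicits.

Definition circle_pos (R : realType) : set R[i] :=
  circle R `&` [set s | 0 <= complex.Re s].
Arguments circle_pos : clear implicits.

Section topological_groups.
Variables (R : realType) (G : zmodType).
Implicit Types mu nu : Topological G.

Definition group_topology nu : Prop :=
  continuous (fun xy : tspace nu * tspace nu =>
    ((xy.1 : G) + (xy.2 : G) : tspace nu)) /\
  continuous (fun x : tspace nu => (- (x : G) : tspace nu)).

(** Characters are functions into [R[i]] with values in the circle; as the
    circle has the subspace topology, continuity is continuity into [R[i]].
    [R[i]^o] is [R[i]] with the topology given by the complex modulus. *)
Definition dual nu : set (G -> R[i]) :=
  [set chi | [/\ range chi `<=` circle R,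
    forall x y : G, chi (x + y) = chi x * chi y &
    continuous (chi : tspace nu -> R[i]^o)]].

Definition quasi_convex nu (A : set G) : Prop :=
  forall x : G, ~ A x ->
    exists chi : G -> R[i],
      [/\ dual nu chi, chi @` A `<=` circle_pos R & ~ circle_pos R (chi x)].

Definition locally_quasi_convex nu : Prop :=
  forall U : set G, @nbhs _ (tspace nu) 0 U ->
    exists V : set G,
      [/\ @nbhs _ (tspace nu) 0 V, quasi_convex nu V & V `<=` U].

Definition LQC nu : Prop :=
  [/\ group_topology nu, hausdorff_space (tspace nu) &
      locally_quasi_convex nu].

Definition compatible mu nu : Prop :=
  group_topology nu /\ dual nu = dual mu.

Definition mackey_in_LQC mu : Prop :=
  LQC mu /\ forall nu, compatible mu nu -> LQC nu -> coarser nu mu.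

(** Total boundedness; the library's [precompact] (contained in a closed
    compact set of the same space) is a different notion. *)
Definition totally_bounded_group nu : Prop :=
  forall U : set G, @nbhs _ (tspace nu) 0 U ->
    exists2 F : set G, finite_set F &
      \bigcup_(f in F) [set f + u | u in U] = [set: G].

End topological_groups.

Arguments dual R {G} nu.

Section null_sequences.
Variable X : topologicalZmodType.

Definition c0_pred : {pred nat -> X} := fun x => `[< x @ \oo --> (0 : X) >].

Fact c0_zmod_closed : zmod_closed c0_pred.
Proof.
split; first by apply/asboolP; exact: cvg_cst.
move=> x y /asboolP x0 /asboolP y0; apply/asboolP.
rewrite -[X in _ --> X](subrr (0 : X)).
apply: (@cvg_comp _ _ _ (fun n => (x n, y n)) (fun z : X * X => z.1 - z.2)
  _ (nbhs ((0, 0) : X * X))); first exact: cvg_pair.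
exact: (@sub_continuous X (0, 0)).
Qed.

HB.instance Definition _ :=
  GRing.isZmodClosed.Build (nat -> X) c0_pred c0_zmod_closed.

Record c0 := C0 { c0_val :> nat -> X ; _ : c0_val \in c0_pred }.

HB.instance Definition _ := [isSub for c0_val].
HB.instance Definition _ := [Choice of c0 by <:].
HB.instance Definition _ := [SubChoice_isSubZmodule of c0 by <:].

(** [X^N] with the group topology in which the sets [V^N], for [V] a
    neighborhood of [0], form a basis of neighborhoods of the neutral element;
    the neighborhoods of [f] are the translates by [f]. *)
Definition uniform_seq : Type := nat -> X.

HB.instance Definition _ := Choice.on uniform_seq.

Definition uniform_seq_nbhs (f : uniform_seq) : set_system uniform_seq :=
  filter_from (nbhs (0 : X)) (fun V => [set g | forall n, V (g n - f n)]).

HB.instance Definition _ := hasNbhs.Build uniform_seq uniform_seq_nbhs.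

Fact uniform_seq_filter (f : uniform_seq) : ProperFilter (nbhs f).
Proof.
apply: filter_from_proper.
  apply: filter_from_filter; first by exists setT; exact: filterT.
  move=> V W V0 W0; exists (V `&` W); first exact: filterI.
  by move=> g gVW; split=> n; case: (gVW n).
by move=> V V0; exists f => n; rewrite subrr; exact: nbhs_singleton.
Qed.

Fact uniform_seq_singleton (f : uniform_seq) (A : set uniform_seq) :
  nbhs f A -> A f.
Proof.
by case=> V V0; apply => n; rewrite subrr; exact: nbhs_singleton.
Qed.

Fact uniform_seq_nbhs_nbhs (f : uniform_seq) (A : set uniform_seq) :
  nbhs f A -> nbhs f (nbhs^~ A).
Proof.
case=> V V0 VA.
have := @add_continuous X (0, 0) V; rewrite /= addr0 => /(_ V0).
case=> -[W1 W2] /= [W10 W20] WV.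
exists W1 => // g gW; exists W2 => // h hW; apply: VA => n.
have -> : h n - f n = (g n - f n) + (h n - g n) by rewrite [RHS]addrC addrA subrK.
by apply: (WV (_, _)); split; [exact: gW|exact: hW].
Qed.

HB.instance Definition _ := Nbhs_isNbhsTopological.Build uniform_seq
  uniform_seq_filter uniform_seq_singleton uniform_seq_nbhs_nbhs.

Definition p0 : Topological c0 :=
  Topological.class (initial_topology (c0_val : c0 -> {ptws nat -> X})).

Definition u0 : Topological c0 :=
  Topological.class (initial_topology (c0_val : c0 -> uniform_seq)).

End null_sequences.

Arguments p0 : clear implicits.
Arguments u0 : clear implicits.

(* Main.v *)
(** Characters of [X]. Averaging over translates gives an invariant mean on the
    uniformly continuous functions of a precompact group, hence an [L^2] norm and
    convolution operators, which commute with translations. Given a nonzero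
    convolution operator [T], averaging [v] against the powers of an [n]-th root of
    unity splits it orthogonally into approximate eigenvectors of one translation;
    doing this for finitely many translations, one keeps a [v] with
    [eps |v|^2 < |T v|^2]. The approximate eigenvalues are almost multiplicative in
    the translation and, as [T] is norm continuous under translation, uniformly
    continuous at [0], so a limit along an ultrafilter is a continuous character;
    choosing the kernel of [T] of the form [k - k (. - x0)] makes it nontrivial at
    [x0]. So compact metrizable groups are locally quasi-convex.

    Equality of duals. If a [u0]-character [chi] were nontrivial on infinitely many
    coordinates, connectedness would give, in any [W^N], elements supported on one
    such coordinate whose values have real part bounded away from [1]; multiplying
    them with signs chosen so that the real part decays geometrically contradicts
    [1/2 < Re chi] on a small [W^N]. So [chi] depends on finitely many coordinates. *)
Require Import Defs.
From HB Require Import structures.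
From mathcomp Require Import all_boot all_order all_algebra.
From mathcomp Require Import complex.
From mathcomp Require cyclic separable cyclotomic.
From mathcomp Require Import all_classical all_reals all_analysis.
From mathcomp Require Import ring lra.

Set Implicit Arguments.
Unset Strict Implicit.
Unset Printing Implicit Defensive.

Import Order.TTheory GRing.Theory Num.Theory.
Import numFieldNormedType.Exports.

Local Open Scope classical_set_scope.
Local Open Scope ring_scope.

(** * The invariant mean of a precompact group *)

(** The covering sets are the translates [U - a]; this sign matches the averages below, which
    evaluate functions at [x + a]. *)
Definition totally_bounded (X : topologicalZmodType) : Prop :=
  forall U : set X, nbhs 0 U -> exists s : seq X, forall x, exists2 a, a \in s & U (x + a).

Section uniformly_continuous_functions.
Variables (R : realType) (X : topologicalZmodType).
Implicit Types f g : X -> R.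

Definition ucont f : Prop :=
  forall e, 0 < e -> \forall u \near (0 : X), forall x, `|f (x + u) - f x| <= e.

Lemma ucont_cst c : ucont (fun=> c).
Proof. by move=> e e0; apply: nearW => u x; rewrite subrr normr0 ltW. Qed.

Lemma ucontD f g : ucont f -> ucont g -> ucont (fun x => f x + g x).
Proof.
move=> uf ug e e0; have e20 : 0 < e / 2 by rewrite divr_gt0.
apply: filterS2 (uf _ e20) (ug _ e20) => u fu gu x.
by rewrite opprD addrACA (le_trans (ler_normD _ _))// [leRHS]splitr lerD.
Qed.

Lemma ucontZ c f : ucont f -> ucont (fun x => c * f x).
Proof.
move=> uf e e0; have c0 : 0 < `|c| + 1 by rewrite ltr_wpDl.
have ec0 : 0 < e / (`|c| + 1) by rewrite divr_gt0.
apply: filterS (uf _ ec0) => u fu x; rewrite -mulrBr normrM.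
rewrite (@le_trans _ _ ((`|c| + 1) * (e / (`|c| + 1))))//.
  by rewrite ler_pM// lerDl.
by rewrite mulrC divfK// gt_eqF.
Qed.

Lemma ucontN f : ucont f -> ucont (fun x => - f x).
Proof.
by move=> /(ucontZ (-1)); congr (ucont _); apply/funext => x; rewrite mulN1r.
Qed.

Lemma ucontB f g : ucont f -> ucont g -> ucont (fun x => f x - g x).
Proof. by move=> uf ug; apply: ucontD => //; exact: ucontN. Qed.

Lemma ucont_shift f t : ucont f -> ucont (fun x => f (x + t)).
Proof.
by move=> uf e e0; apply: filterS (uf _ e0) => u fu x; rewrite addrAC.
Qed.

Hypothesis tbX : totally_bounded X.

(** Up to an error of at most 1, [f x] is the value at one of the finitely many points [- a]. *)
Lemma ucont_bounded f : ucont f -> exists2 B, 0 <= B & forall x, `|f x| <= B.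
Proof.
move=> uf; have [s sP] := tbX (uf 1 ltr01).
exists (1 + \sum_(a <- s) `|f (- a)|) => [|x].
  by rewrite addr_ge0// sumr_ge0.
have [a as_ ua] := sP x; have := ua (- a); rewrite addrCA addNr addr0 => fx.
have -> : f x = (f x - f (- a)) + f (- a) by rewrite subrK.
rewrite (le_trans (ler_normD _ _))// lerD//.
by rewrite (big_rem a)//= lerDl sumr_ge0.
Qed.

Lemma ucontM f g : ucont f -> ucont g -> ucont (fun x => f x * g x).
Proof.
move=> uf ug e e0; have [B B0 fB] := ucont_bounded uf; have [C C0 gC] := ucont_bounded ug.
pose d := e / (B + C + 1); have BC0 : 0 < B + C + 1 by rewrite ltr_wpDl// addr_ge0.
have d0 : 0 < d by rewrite divr_gt0.
apply: filterS2 (uf _ d0) (ug _ d0) => u fu gu x.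
have -> : f (x + u) * g (x + u) - f x * g x =
  f (x + u) * (g (x + u) - g x) + g x * (f (x + u) - f x) by ring.
rewrite (le_trans (ler_normD _ _))// !normrM.
rewrite (@le_trans _ _ (B * d + C * d))// ?lerD ?ler_pM//.
rewrite -mulrDl -[leRHS](@divfK _ (B + C + 1)) ?gt_eqF// -/d mulrC.
by rewrite ler_wpM2l ?(ltW d0)// lerDl.
Qed.

End uniformly_continuous_functions.

(** * Finite averages of translates and the constants that they approximate *)

Section is_mean.
Variables (R : realType) (X : topologicalZmodType).
Implicit Types (f g : X -> R) (s t : seq X).

Definition avg s f x : R := (size s)%:R^-1 * \sum_(a <- s) f (x + a).

Lemma size_neq0 s : s != [::] -> (size s)%:R != 0 :> R.
Proof. by rewrite pnatr_eq0 size_eq0. Qed.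

Lemma sum_cst s (c : R) : \sum_(a <- s) c = (size s)%:R * c.
Proof. by rewrite big_const_seq count_predT iter_addr_0 mulr_natl. Qed.

Lemma avg_cst s c x : s != [::] -> avg s (fun=> c) x = c.
Proof. by move=> s0; rewrite /avg sum_cst mulKf// size_neq0. Qed.

Lemma avgD s f g x : avg s (fun x => f x + g x) x = avg s f x + avg s g x.
Proof. by rewrite /avg big_split mulrDr. Qed.

Lemma avgZ s c f x : avg s (fun x => c * f x) x = c * avg s f x.
Proof. by rewrite /avg -mulr_sumr mulrCA. Qed.

Lemma avgB s f g x : avg s (fun x => f x - g x) x = avg s f x - avg s g x.
Proof. by rewrite /avg sumrB mulrBr. Qed.

Lemma ler_avg s f g x : (forall y, f y <= g y) -> avg s f x <= avg s g x.
Proof. by move=> fg; rewrite ler_wpM2l ?invr_ge0// ler_sum. Qed.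

Lemma avg_dist s f c e x : s != [::] -> (forall y, `|f y - c| <= e) ->
  `|avg s f x - c| <= e.
Proof.
move=> s0 fc; rewrite -(avg_cst c x s0) -avgB.
rewrite /avg normrM ger0_norm ?invr_ge0// mulrC ler_pdivrMr ?lt_neqAle 1?eq_sym ?size_neq0//=.
by rewrite (le_trans (ler_norm_sum _ _ _))// mulrC -sum_cst ler_sum.
Qed.

(** Composed averages are averages over pairwise sums counted with multiplicity; hence translations
    are listed in sequences rather than sets. *)
Lemma avg_allpairs s t f x :
  avg [seq a + b | a <- s, b <- t] f x = avg s (avg t f) x.
Proof.
rewrite /avg size_allpairs natrM invfM -mulrA mulr_sumr big_allpairs_dep.
congr (_ * _); apply: eq_bigr => a _; rewrite -mulr_sumr; congr (_ * _).
by apply: eq_bigr => b _; rewrite addrA.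
Qed.

Lemma avgC s t f x : avg s (avg t f) x = avg t (avg s f) x.
Proof.
rewrite -!avg_allpairs /avg !size_allpairs mulnC; congr (_ * _).
rewrite !big_allpairs_dep exchange_big; apply: eq_bigr => a _.
by apply: eq_bigr => b _; rewrite [a + b]addrC.
Qed.

Lemma allpairs_neq0 s t : s != [::] -> t != [::] ->
  [seq a + b | a <- s, b <- t] != [::].
Proof. by rewrite -!size_eq0 size_allpairs muln_eq0 negb_or => -> ->. Qed.

(** Von Neumann's mean: a constant that is a uniform limit of finite averages of translates. *)
Definition is_mean f c : Prop :=
  forall e, 0 < e -> exists2 s, s != [::] & forall x, `|avg s f x - c| <= e.

(** Averages commute, so the double average over [s] and [t] is uniformly close to both [c] and
    [d]. *)
Lemma is_mean_uniq f c d : is_mean f c -> is_mean f d -> c = d.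
Proof.
move=> fc fd; apply/eqP; rewrite -subr_eq0 -normr_le0; apply/ler_addgt0Pl => e e0.
have [s s0 sc] := fc _ (divr_gt0 e0 (ltr0n _ 2)).
have [t t0 td] := fd _ (divr_gt0 e0 (ltr0n _ 2)).
rewrite addr0 -(subrKA (avg t (avg s f) 0)) (le_trans (ler_normD _ _))// [leRHS]splitr lerD//.
  by rewrite distrC avg_dist.
by rewrite avgC avg_dist.
Qed.

(** Averaging once more does not spoil closeness to a constant, so the pairwise sums serve both
    functions. *)
Lemma is_meanD f g c d : is_mean f c -> is_mean g d ->
  is_mean (fun x => f x + g x) (c + d).
Proof.
move=> fc gd e e0.
have [s s0 sc] := fc _ (divr_gt0 e0 (ltr0n _ 2)).
have [t t0 td] := gd _ (divr_gt0 e0 (ltr0n _ 2)).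
exists [seq a + b | a <- s, b <- t]; first exact: allpairs_neq0.
move=> x; rewrite avgD opprD addrACA (le_trans (ler_normD _ _))// [leRHS]splitr.
by rewrite !avg_allpairs lerD// ?[avg s (avg t f) x]avgC avg_dist.
Qed.

Lemma is_meanZ a f c : is_mean f c -> is_mean (fun x => a * f x) (a * c).
Proof.
move=> fc e e0; have a0 : 0 < `|a| + 1 by rewrite ltr_wpDl.
have [s s0 sc] := fc _ (divr_gt0 e0 a0); exists s => // x.
rewrite avgZ -mulrBr normrM.
rewrite (@le_trans _ _ ((`|a| + 1) * (e / (`|a| + 1))))//; last by rewrite mulrC divfK// gt_eqF.
by rewrite ler_pM// lerDl.
Qed.

Lemma is_mean_shift (t : X) f c : is_mean f c -> is_mean (fun x => f (x + t)) c.
Proof.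
move=> fc e /fc[s s0 sc]; exists s => // x.
have -> : avg s (fun x => f (x + t)) x = avg s f (x + t).
  by congr (_ * _); apply: eq_bigr => a _; rewrite addrAC.
exact: sc.
Qed.

Lemma is_mean_ge f c b : (forall x, b <= f x) -> is_mean f c -> b <= c.
Proof.
move=> bf fc; apply/ler_addgt0Pl => e /fc[s s0 sc].
have := ler_avg s 0 bf; rewrite avg_cst// => /le_trans; apply.
by have := sc 0; rewrite ler_distl [c + e]addrC => /andP[].
Qed.

Hypothesis tbX : totally_bounded X.

(** While the oscillation exceeds [e], some value lies below [u - e], and every point has a
    translate by the net [s0] where the value is at most [u - e / 2]. Averaging over the net
    therefore lowers the upper bound [u] by a fixed amount, which can happen only finitely often. *)
Lemma ucont_avg_close f e : ucont f -> 0 < e ->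
  exists2 s, s != [::] & forall x y, avg s f x - avg s f y <= e.
Proof.
move=> uf e0; have [B B0 fB] := ucont_bounded tbX uf.
pose U := [set u : X | forall x, `|f (x + u) - f x| <= e / 2].
have [s0 s0P] : exists s : seq X, forall x, exists2 a, a \in s & U (x + a).
  by apply/tbX/uf; rewrite divr_gt0.
have s0N : s0 != [::] by have [a] := s0P 0; case: s0 {s0P}.
(* The drop per round: one of the [size s0] terms is smaller by [e / 2]. *)
pose c := e / 2 / (size s0)%:R.
have c0 : 0 < c by rewrite !divr_gt0// lt_neqAle eq_sym size_neq0//=.
have avgU s u x : s != [::] -> U u -> avg s f (x + u) <= avg s f x + e / 2.
  move=> sN Uu; rewrite -lerBlDl -(avg_cst (e / 2) x sN).
  have -> : avg s f (x + u) = avg s (fun x => f (x + u)) x.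
    by congr (_ * _); apply: eq_bigr => a _; rewrite addrAC.
  rewrite -avgB ler_avg// => y.
  by rewrite (le_trans (ler_norm _)).
suff P (n : nat) : exists2 s, s != [::] &
    (forall x y, avg s f x - avg s f y <= e) \/
    exists l u, [/\ u - l <= 2 * B - n%:R * c,
      forall x, l <= avg s f x & forall x, avg s f x <= u].
  (* More than [2 * B / c] rounds would make [u - l] negative. *)
  have [s sN [?|[l [u [lu fl fu]]]]] := P (Num.truncn (2 * B / c)).+1; first by exists s.
  have : l <= u by rewrite (le_trans (fl 0)).
  rewrite -subr_ge0 => /le_trans/(_ lu); rewrite subr_ge0 -ler_pdivlMr// leNgt.
  by rewrite truncnS_gt.
elim: n => [|n [s sN IH]].
  exists [:: 0] => //; right; exists (- B), B.
  by split=> [|x|x]; rewrite ?mul0r ?subr0 ?opprK ?mulr_natl//;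
    rewrite /avg invr1 mul1r big_seq1 addr0; have := fB x; rewrite ler_norml => /andP[].
case: IH => [?|[l [u [lu fl fu]]]]; first by exists s => //; left.
have [?|/existsNP[x /existsNP[y /negP]]] := pselect (forall x y, avg s f x - avg s f y <= e).
  by exists s => //; left.
rewrite -ltNge => xy; exists [seq a + b | a <- s0, b <- s]; first exact: allpairs_neq0.
right; exists l, (u - c); split=> [|z|z].
- by move: lu; rewrite -natr1 mulrDl mul1r; lra.
- by rewrite avg_allpairs -(avg_cst l z s0N) ler_avg.
rewrite avg_allpairs.
have [a as0 Ua] := s0P (z - y).
rewrite /avg (big_rem a)//= -/(avg _ _ _).
have : avg s f (z + a) <= u - e / 2.
  have -> : z + a = y + (z - y + a) by rewrite addrA [y + _]addrC subrK.
  rewrite (le_trans (avgU _ _ _ sN Ua))//; have := fu x; lra.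
move=> ?; have N0 : (0 < size s0)%N by rewrite lt0n size_eq0.
have N0R : 0 < (size s0)%:R :> R by rewrite ltr0n.
have : \sum_(b <- rem a s0) avg s f (z + b) <= (size s0)%:R * u - u.
  rewrite (@le_trans _ _ (\sum_(b <- rem a s0) u))//; first exact: ler_sum.
  by rewrite sum_cst size_rem// -subn1 natrB// mulrBl mul1r.
move=> ?; rewrite ler_pdivrMl// /c mulrBr [_ * (_ / _ / _)]mulrC divfK ?gt_eqF//.
lra.
Qed.

End is_mean.

(** * The mean as a positive invariant functional *)

Section mean.
Variables (R : realType) (X : topologicalZmodType).
Hypothesis tbX : totally_bounded X.
Implicit Types f g : X -> R.

(** The mean is the infimum of the uniform upper bounds of averages: as averages commute, one that
    oscillates by at most [e] exceeds no such bound by more than [e]. *)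
Lemma is_mean_exists f : ucont f -> exists c, is_mean f c.
Proof.
move=> uf; pose A := [set a : R | exists2 s, s != [::] & forall x, avg s f x <= a].
have key e s a : 0 < e -> s != [::] -> (forall x y, avg s f x - avg s f y <= e) ->
    A a -> avg s f 0 - e <= a.
  move=> e0 sN se [t tN ta]; rewrite -(avg_cst a 0 sN).
  rewrite (@le_trans _ _ (avg s (avg t f) 0))//; last exact: ler_avg.
  rewrite avgC -(avg_cst (avg s f 0 - e) 0 tN) ler_avg// => y.
  by rewrite lerBlDr -lerBlDl.
have [s1 s1N s1e] := ucont_avg_close tbX uf ltr01.
have hA : has_inf A.
  split; last by exists (avg s1 f 0 - 1) => a; exact: key.
  by exists (avg s1 f 0 + 1), s1 => // x; rewrite -lerBlDl.
exists (inf A) => e e0; have e20 : 0 < e / 2 by rewrite divr_gt0.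
have [s sN se] := ucont_avg_close tbX uf e20.
exists s => // x; rewrite ler_distl.
have h1 : avg s f 0 - e / 2 <= inf A.
  by apply: lb_le_inf => [|a]; [case: hA|exact: key].
have h2 : inf A <= avg s f 0 + e / 2.
  by apply: ge_inf; [case: hA|exists s => // y; rewrite -lerBlDl].
have := se 0 x; have := se x 0; lra.
Qed.

Definition mean f : R := xget 0 (is_mean f).

Lemma meanP f : ucont f -> is_mean f (mean f).
Proof. by move=> /is_mean_exists; exact: xgetPex. Qed.

Lemma mean_eq f c : is_mean f c -> mean f = c.
Proof. by move=> fc; apply: (is_mean_uniq _ fc); apply: xgetPex; exists c. Qed.

Lemma meanD f g : ucont f -> ucont g -> mean (fun x => f x + g x) = mean f + mean g.
Proof. by move=> uf ug; apply/mean_eq/is_meanD; exact: meanP. Qed.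

Lemma meanZ c f : ucont f -> mean (fun x => c * f x) = c * mean f.
Proof. by move=> uf; apply/mean_eq/is_meanZ/meanP. Qed.

Lemma mean_shift t f : ucont f -> mean (fun x => f (x + t)) = mean f.
Proof. by move=> uf; apply/mean_eq/is_mean_shift/meanP. Qed.

Lemma mean_cst c : mean (fun=> c) = c.
Proof.
by apply/mean_eq => e e0; exists [:: 0] => // x; rewrite avg_cst// subrr normr0 ltW.
Qed.

Lemma mean_ge0 f : ucont f -> (forall x, 0 <= f x) -> 0 <= mean f.
Proof. by move=> uf f0; apply: is_mean_ge f0 (meanP uf). Qed.

Lemma meanB f g : ucont f -> ucont g -> mean (fun x => f x - g x) = mean f - mean g.
Proof.
move=> uf ug; rewrite meanD//; last exact: ucontN.
by congr (_ + _); under eq_fun do rewrite -mulN1r; rewrite meanZ// mulN1r.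
Qed.

Lemma ler_mean f g : ucont f -> ucont g -> (forall x, f x <= g x) -> mean f <= mean g.
Proof.
move=> uf ug fg; rewrite -subr_ge0 -meanB//; apply: mean_ge0; first exact: ucontB.
by move=> x; rewrite subr_ge0.
Qed.

Lemma ucont_sum (I : Type) (r : seq I) (F : I -> X -> R) :
  (forall i, ucont (F i)) -> ucont (fun x => \sum_(i <- r) F i x).
Proof.
move=> uF; elim: r => [|i r IH].
  by under [X in ucont X]eq_fun do rewrite big_nil; exact: ucont_cst.
by under [X in ucont X]eq_fun do rewrite big_cons; exact: ucontD.
Qed.

Lemma mean_sum (I : Type) (r : seq I) (F : I -> X -> R) :
  (forall i, ucont (F i)) ->
  mean (fun x => \sum_(i <- r) F i x) = \sum_(i <- r) mean (F i).
Proof.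
move=> uF; elim: r => [|i r IH].
  by under eq_fun do rewrite big_nil; rewrite mean_cst big_nil.
under eq_fun do rewrite big_cons; rewrite meanD//; last exact: ucont_sum.
by rewrite IH big_cons.
Qed.

(** Finitely many translates of [f] add up to at least [f a / 2] everywhere, and all of them have
    the same mean. *)
Lemma mean_gt0 f a : ucont f -> (forall x, 0 <= f x) -> 0 < f a -> 0 < mean f.
Proof.
move=> uf f0 fa; have fa2 : 0 < f a / 2 by rewrite divr_gt0.
have [s sP] := tbX (uf _ fa2).
have sN : s != [::] by have [b] := sP 0; case: s {sP}.
have : \sum_(b <- s) mean (fun x => f (x + (a + b))) = (size s)%:R * mean f.
  by rewrite -sum_cst; apply: eq_bigr => b _; rewrite mean_shift.
rewrite -mean_sum => [H|b]; last exact: ucont_shift.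
have sR : 0 < (size s)%:R :> R by rewrite ltr0n lt0n size_eq0.
rewrite -(pmulr_rgt0 _ sR) -H.
rewrite (lt_le_trans fa2)// -[f a / 2]mean_cst ler_mean//; first exact: ucont_cst.
  by apply: ucont_sum => b; exact: ucont_shift.
move=> x; have [b bs /(_ a)] := sP x; rewrite (big_rem b)//= => fb.
rewrite -[leLHS]addr0 lerD ?sumr_ge0// addrCA.
by move: fb; rewrite ler_distl => /andP[+ _]; apply: le_trans; lra.
Qed.

(** The mean of [(f - t * g) ^+ 2] is nonnegative for every [t]; for [G] nonzero the choice
    [t = H / G] minimizes it. *)
Lemma mean_CauchySchwarz f g : ucont f -> ucont g ->
  mean (fun x => f x * g x) ^+ 2 <=
  mean (fun x => f x ^+ 2) * mean (fun x => g x ^+ 2).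
Proof.
move=> uf ug; have uM (h k : X -> R) : ucont h -> ucont k -> ucont (fun x => h x * k x).
  by move=> *; exact: ucontM.
under [X in _ <= mean X * _]eq_fun do rewrite expr2.
under [X in _ <= _ * mean X]eq_fun do rewrite expr2.
set F := mean (fun x => f x * f x); set G := mean (fun x => g x * g x).
set H := mean (fun x => f x * g x).
have Q t : 0 <= F - 2 * t * H + t ^+ 2 * G.
  rewrite /F /G /H -!meanZ; do ?exact: uM.
  rewrite -meanB -?meanD; do ?[exact: uM|exact/ucontZ/uM|apply: ucontB].
  apply: mean_ge0 => [|x]; first apply: ucontD.
  - by apply: ucontB; [exact: uM|exact/ucontZ/uM].
  - exact/ucontZ/uM.
  have -> : f x * f x - 2 * t * (f x * g x) + t ^+ 2 * (g x * g x) = (f x - t * g x) ^+ 2 by ring.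
  exact: sqr_ge0.
have [G0|G0] := eqVneq G 0.
  have [->|H0] := eqVneq H 0; first by rewrite G0 mulr0 expr0n.
  (* With [G = 0] the expression at this [t] equals [- 1]. *)
  have := Q ((F + 1) / (2 * H)); rewrite G0.
  have -> : 2 * ((F + 1) / (2 * H)) * H = F + 1 by field.
  lra.
have G1 : 0 < G.
  by rewrite lt_neqAle eq_sym G0; apply: mean_ge0 => [|x]; [exact: uM|rewrite -expr2 sqr_ge0].
have := Q (H / G); rewrite -(pmulr_lge0 _ G1).
have -> : (F - 2 * (H / G) * H + (H / G) ^+ 2 * G) * G = F * G - H ^+ 2 by field.
by rewrite subr_ge0.
Qed.

End mean.

(** * Approximate eigenfunctions of translations *)

Section roots_of_unity.
Variable C : numClosedFieldType.

(** ['X^n - 1] splits and is separable, so it has [n] distinct roots, and these include a primitive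
    one. *)
Lemma prim_root_exists n : (0 < n)%N -> exists w : C, n.-primitive_root w.
Proof.
move=> n0; pose p : {poly C} := 'X^n - 1.
have [r Dp] := closed_field_poly_normal p.
move: Dp; rewrite lead_coefXnsubC// scale1r => Dp.
have rn1 : all n.-unity_root r by apply/allP => z; rewrite -root_prod_XsubC -Dp.
have sz_r : (n < (size r).+1)%N by rewrite -(size_prod_XsubC r id) -Dp size_XnsubC.
have [|z] := hasP (cyclic.has_prim_root n0 rn1 _ sz_r); last by exists z.
by rewrite -separable.separable_prod_XsubC -Dp cyclotomic.separable_Xn_sub_1// pnatr_eq0 -lt0n.
Qed.

Lemma sum_prim_root n (w : C) i j : n.-primitive_root w -> (i < n)%N -> (j < n)%N ->
  \sum_(m < n) w ^+ (i * m) * (w ^+ (j * m))^-1 = n%:R *+ (i == j).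
Proof.
move=> wn ltin ltjn; have w0 : w != 0 by rewrite (prim_root_eq0 wn) -lt0n (prim_order_gt0 wn).
have E m : w ^+ (i * m) * (w ^+ (j * m))^-1 = (w ^+ i / w ^+ j) ^+ m.
  by rewrite expr_div_n -!exprM.
under eq_bigr do rewrite E.
have [->|ij] := eqVneq i j.
  by rewrite divff ?expf_neq0//; under eq_bigr do rewrite expr1n; rewrite sumr_const card_ord.
have := subrX1 (w ^+ i / w ^+ j) n.
rewrite expr_div_n -!exprM ![(_ * n)%N]mulnC !exprM (prim_expr_order wn) !expr1n divrr ?unitr1//.
rewrite subrr => /esym/eqP; rewrite mulf_eq0 subr_eq0 => /orP[|/eqP//].
rewrite -subr_eq0 -[1](divff (expf_neq0 j w0)) -mulrBl mulf_eq0 invr_eq0.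
rewrite (negPf (expf_neq0 j w0)) orbF.
by rewrite subr_eq0 (eq_prim_root_expr wn) !modn_small// (negPf ij).
Qed.

Lemma norm_prim_root n (w : C) : n.-primitive_root w -> `|w| = 1.
Proof.
move=> wn; apply/eqP; rewrite -(pexpr_eq1 (prim_order_gt0 wn))//.
by rewrite -normrX (prim_expr_order wn) normr1.
Qed.

Lemma dft_Parseval n (w : C) (u : nat -> C) : n.-primitive_root w ->
  \sum_(m < n) `|\sum_(j < n) (w ^+ (j * m))^-1 * u j| ^+ 2 =
  n%:R * \sum_(j < n) `|u j| ^+ 2.
Proof.
move=> wn; have cw k : ((w ^+ k)^-1)^* = w ^+ k.
  by rewrite invC_norm normrX (norm_prim_root wn) !expr1n invr1 mul1r conjCK.
under eq_bigr => m _.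
  rewrite normCK rmorph_sum/= big_distrlr/=.
  under eq_bigr do under eq_bigr do rewrite rmorphM/= cw.
  over.
rewrite exchange_big mulr_sumr; apply: eq_bigr => i _ /=.
rewrite exchange_big/= (bigD1 i)//= [X in _ + X]big1 ?addr0 => [|j ji].
  rewrite normCK -(@eq_bigr _ _ _ _ _ _ (fun m : 'I_n =>
    (w ^+ (i * m) * (w ^+ (i * m))^-1) * (u i * (u i)^*))).
    by rewrite -mulr_suml sum_prim_root// eqxx.
  by move=> m _; ring.
rewrite -(@eq_bigr _ _ _ _ _ _ (fun m : 'I_n =>
  (w ^+ (j * m) * (w ^+ (i * m))^-1) * (u i * (u j)^*))).
  by rewrite -mulr_suml sum_prim_root// val_eqE (negPf ji) mulr0n mul0r.
by move=> m _; ring.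
Qed.

End roots_of_unity.

(** * Squared [L^2] norms and convolution operators *)

Section approximate_eigenfunctions.
Variables (R : realType) (X : topologicalZmodType).
Hypothesis tbX : totally_bounded X.
Local Open Scope complex_scope.
Local Notation Re := complex.Re.
Local Notation Im := complex.Im.
Implicit Types (k : X -> R) (v : X -> R[i]).

(** The norm on [R[i]] takes values in [R[i]]; this squared modulus is real, as means and order
    arguments require. *)
Definition nsq (z : R[i]) : R := Re z ^+ 2 + Im z ^+ 2.

Lemma nsqE z : (nsq z)%:C = `|z| ^+ 2.
Proof. exact: add_Re2_Im2. Qed.

Lemma nsq_ge0 z : 0 <= nsq z.
Proof. by rewrite addr_ge0 ?sqr_ge0. Qed.

Lemma nsq_le0 z : nsq z <= 0 -> z = 0.
Proof.
move=> z0; have : nsq z == 0 by rewrite eq_le z0 nsq_ge0.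
rewrite /nsq paddr_eq0 ?sqr_ge0// !sqrf_eq0 => /andP[/eqP Re0 /eqP Im0].
by apply/eqP; rewrite eq_complex Re0 Im0 !eqxx.
Qed.

Lemma nsq1_neq0 z : nsq z = 1 -> z != 0.
Proof.
apply: contra_eq_neq => ->; rewrite /nsq/= expr0n addr0 eq_sym.
exact: oner_neq0.
Qed.

Lemma nsqM z w : nsq (z * w) = nsq z * nsq w.
Proof. by case: z w => [a b] [c d]; rewrite /nsq/=; ring. Qed.

(** A substitute for the triangle inequality without square roots; its factors 2 are the source of
    the constants in later estimates. *)
Lemma nsqD z w : nsq (z + w) <= 2 * nsq z + 2 * nsq w.
Proof.
case: z w => [a b] [c d]; rewrite /nsq/=.
have := sqr_ge0 (a - c); have := sqr_ge0 (b - d); lra.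
Qed.

Lemma nsqN z : nsq (- z) = nsq z.
Proof. by case: z => [a b]; rewrite /nsq/= !sqrrN. Qed.

Lemma nsq_real (a : R) : nsq a%:C = a ^+ 2.
Proof. by rewrite /nsq/= expr0n addr0. Qed.

Lemma nsq_norm1 z : `|z| = 1 -> nsq z = 1.
Proof. by move=> z1; apply: complexI; rewrite nsqE z1 expr1n. Qed.

Definition ucontC v := ucont (fun x => Re (v x)) /\ ucont (fun x => Im (v x)).

Lemma ucontCD v w : ucontC v -> ucontC w -> ucontC (fun x => v x + w x).
Proof.
move=> [v1 v2] [w1 w2]; split; under [X in ucont X]eq_fun do rewrite raddfD/=;
  exact: ucontD.
Qed.

Lemma ucontCZ z v : ucontC v -> ucontC (fun x => z * v x).
Proof.
case: z => a b [v1 v2].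
have E x : (a +i* b) * v x = (a * Re (v x) - b * Im (v x)) +i* (a * Im (v x) + b * Re (v x)).
  by case: (v x).
split; under [X in ucont X]eq_fun do rewrite E/=.
  by apply: ucontB; exact: ucontZ.
by apply: ucontD; exact: ucontZ.
Qed.

Lemma ucontCB v w : ucontC v -> ucontC w -> ucontC (fun x => v x - w x).
Proof.
move=> uv uw; under [X in ucontC X]eq_fun do rewrite -mulN1r.
by apply: ucontCD => //; exact: ucontCZ.
Qed.

Lemma ucontC_shift t v : ucontC v -> ucontC (fun x => v (x + t)).
Proof. by move=> [v1 v2]; split; [exact: ucont_shift v1|exact: ucont_shift v2]. Qed.

Lemma ucontC_sum (I : Type) (r : seq I) (F : I -> X -> R[i]) :
  (forall i, ucontC (F i)) -> ucontC (fun x => \sum_(i <- r) F i x).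
Proof.
move=> uF; elim: r => [|i r IH].
  by under [X in ucontC X]eq_fun do rewrite big_nil; split; exact: ucont_cst.
by under [X in ucontC X]eq_fun do rewrite big_cons; exact: ucontCD.
Qed.

Lemma ucont_nsq v : ucontC v -> ucont (fun x => nsq (v x)).
Proof. by move=> [v1 v2]; apply: ucontD; apply: ucontM. Qed.

(** The squared [L^2] norm for the invariant mean. *)
Definition energy v : R := mean (fun x => nsq (v x)).

Lemma energy_ge0 v : ucontC v -> 0 <= energy v.
Proof. by move=> uv; apply: mean_ge0 => [//||x]; [exact: ucont_nsq|exact: nsq_ge0]. Qed.

Lemma energyZ z v : ucontC v -> energy (fun x => z * v x) = nsq z * energy v.
Proof.
move=> uv; rewrite /energy; under eq_fun do rewrite nsqM.
by rewrite meanZ//; exact: ucont_nsq.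
Qed.

Lemma energy_shift t v : ucontC v -> energy (fun x => v (x + t)) = energy v.
Proof. by move=> uv; rewrite /energy (mean_shift tbX t (ucont_nsq uv)). Qed.

Lemma energyD v w : ucontC v -> ucontC w ->
  energy (fun x => v x + w x) <= 2 * energy v + 2 * energy w.
Proof.
move=> uv uw; have [uv' uw'] := (ucont_nsq uv, ucont_nsq uw).
rewrite /energy -!meanZ// -meanD; try exact: ucontZ; try done.
apply: ler_mean => //; first exact/ucont_nsq/ucontCD.
  by apply: ucontD; exact: ucontZ.
by move=> x; exact: nsqD.
Qed.

Lemma energyN v : energy (fun x => - v x) = energy v.
Proof. by rewrite /energy; under eq_fun do rewrite nsqN. Qed.

Lemma energyB v w : ucontC v -> ucontC w ->
  energy (fun x => v x - w x) <= 2 * energy v + 2 * energy w.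
Proof.
move=> uv uw; rewrite -(energyN w); apply: energyD => //.
by under [X in ucontC X]eq_fun do rewrite -mulN1r; exact: ucontCZ.
Qed.

(* convolution with the kernel [fun y => k (- y)] *)
Definition convol k v x : R[i] :=
  mean (fun y => k (y - x) * Re (v y)) +i* mean (fun y => k (y - x) * Im (v y)).

Section conv_theory.
Variable k : X -> R.
Hypothesis uk : ucont k.

Let uM f t : ucont f -> ucont (fun y => k (y + t) * f y).
Proof. by move=> uf; apply: ucontM => //; exact: ucont_shift. Qed.

Lemma convD v w x : ucontC v -> ucontC w ->
  convol k (fun x => v x + w x) x = convol k v x + convol k w x.
Proof.
move=> [v1 v2] [w1 w2]; rewrite /convol; apply/eqP; rewrite eq_complex/= -!meanD//; do ?exact: uM.
by apply/andP; split; apply/eqP; congr mean; apply/funext => y; rewrite raddfD/= mulrDr.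
Qed.

Lemma convZ z v x : ucontC v -> convol k (fun x => z * v x) x = z * convol k v x.
Proof.
case: z => a b [v1 v2]; rewrite /convol; apply/eqP; rewrite eq_complex/=.
rewrite -!meanZ//; do ?exact: uM.
rewrite -meanB -?meanD//; do ?exact/ucontZ/uM.
by apply/andP; split; apply/eqP; congr mean; apply/funext => y; case: (v y) => c d/=; ring.
Qed.

(** Invariance of the mean: the operator commutes with translations. *)
Lemma conv_shift t v x : ucontC v -> convol k (fun x => v (x + t)) x = convol k v (x + t).
Proof.
move=> [v1 v2]; have E (f : X -> R) : ucont f ->
    mean (fun y => k (y - x) * f (y + t)) = mean (fun y => k (y - (x + t)) * f y).
  move=> uf; rewrite -(mean_shift tbX t (uM _ uf)); congr mean; apply/funext => y.
  by congr (k _ * _); rewrite opprD addrA addrAC addrK.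
by rewrite /convol (E _ v1) (E _ v2).
Qed.

Lemma conv_sum (I : Type) (r : seq I) (F : I -> X -> R[i]) x :
  (forall i, ucontC (F i)) ->
  convol k (fun x => \sum_(i <- r) F i x) x = \sum_(i <- r) convol k (F i) x.
Proof.
move=> uF; elim: r => [|i r IH].
  rewrite big_nil /convol; under eq_fun do rewrite big_nil mulr0.
  rewrite mean_cst; under eq_fun do rewrite big_nil mulr0.
  by rewrite mean_cst.
rewrite big_cons -IH -convD//; last exact: ucontC_sum.
by congr (convol k _ x); apply/funext => y; rewrite big_cons.
Qed.

Lemma nsq_conv v x : ucontC v ->
  nsq (convol k v x) <= mean (fun y => k y ^+ 2) * energy v.
Proof.
move=> [v1 v2]; have uk2 : ucont (fun y => k y ^+ 2) by exact: ucontM.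
have CS (f : X -> R) : ucont f ->
    mean (fun y => k (y - x) * f y) ^+ 2 <= mean (fun y => k y ^+ 2) * mean (fun y => f y ^+ 2).
  move=> uf; rewrite -(mean_shift tbX (- x) uk2).
  by apply: mean_CauchySchwarz => //; exact: ucont_shift.
rewrite /nsq/= (le_trans (lerD (CS _ v1) (CS _ v2)))//.
by rewrite -mulrDr -meanD//; exact: ucontM.
Qed.

End conv_theory.

Lemma convBl k l v x : ucont k -> ucont l -> ucontC v ->
  convol (fun y => k y - l y) v x = convol k v x - convol l v x.
Proof.
move=> uk ul [v1 v2]; rewrite /convol; apply/eqP; rewrite eq_complex/=.
have uM f g t : ucont f -> ucont g -> ucont (fun y : X => (f (y + t) : R) * g y).
  by move=> uf ug; apply: ucontM => //; exact: ucont_shift.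
rewrite -!meanB//; do ?exact: uM.
by apply/andP; split; apply/eqP; congr mean; apply/funext => y; rewrite mulrBl.
Qed.

Lemma conv_kernel_shift k t v x : convol (fun y => k (y - t)) v x = convol k v (x + t).
Proof. by rewrite /convol; congr (_ +i* _); congr mean; apply/funext => y; rewrite opprD addrA. Qed.

Lemma ucontC_conv k v : ucont k -> ucontC v -> ucontC (convol k v).
Proof.
move=> uk [v1 v2].
suff uc (f : X -> R) : ucont f -> ucont (fun x => mean (fun y => k (y - x) * f y)).
  by split; exact: uc.
move=> uf e e0; have [B B0 fB] := ucont_bounded tbX uf.
have B1 : 0 < B + 1 by rewrite ltr_wpDl.
have uM t : ucont (fun y => k (y + t) * f y) by apply: ucontM => //; exact: ucont_shift.
apply: filterS (uk _ (divr_gt0 e0 B1)) => u ku x.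
rewrite -meanB// ler_norml.
have kfe y : `|k (y - (x + u)) * f y - k (y - x) * f y| <= e.
  rewrite -mulrBl normrM -(divfK (lt0r_neq0 B1) e) ler_pM//.
    by have := ku (y - (x + u)); rewrite opprD addrA addrNK distrC.
  by rewrite (le_trans (fB y))// lerDl.
by apply/andP; split; [rewrite -[leLHS](mean_cst X)|rewrite -[leRHS](mean_cst X)];
  apply: ler_mean => //; do ?[exact: ucont_cst|exact: ucontB];
  move=> // y; have := kfe y; rewrite ler_norml => /andP[].
Qed.

Lemma energy_conv k v : ucont k -> ucontC v ->
  energy (convol k v) <= mean (fun y => k y ^+ 2) * energy v.
Proof.
move=> uk uv; rewrite -[leRHS](mean_cst X); apply: ler_mean => //.
- exact/ucont_nsq/ucontC_conv.
- exact: ucont_cst.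
- by move=> x; exact: nsq_conv.
Qed.

(** * Splitting along the approximate eigenvalues of one translation *)

Section spectral_parts.
Variables (n : nat) (w : R[i]) (t : X).
Hypothesis wn : n.-primitive_root w.
Implicit Type m : nat.

(* the approximate eigenprojection of the translation by [t] for the eigenvalue
   [w ^+ m] *)
Definition spart v m x : R[i] :=
  n%:R^-1 * \sum_(j < n) (w ^+ (j * m))^-1 * v (x + t *+ j).

Let n0 : n%:R != 0 :> R[i].
Proof. by rewrite pnatr_eq0 -lt0n (prim_order_gt0 wn). Qed.

Lemma ucontC_spart v m : ucontC v -> ucontC (spart v m).
Proof.
by move=> uv; apply/ucontCZ/ucontC_sum => j; apply: ucontCZ; exact: ucontC_shift.
Qed.

Lemma sum_nsq_spart v x :
  \sum_(m < n) nsq (spart v m x) = n%:R^-1 * \sum_(j < n) nsq (v (x + t *+ j)).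
Proof.
apply: complexI; rewrite rmorph_sum rmorphM fmorphV rmorph_nat rmorph_sum/=.
under eq_bigr do rewrite nsqE normrM exprMn.
under [in RHS]eq_bigr do rewrite nsqE.
rewrite -mulr_sumr (dft_Parseval (fun j => v (x + t *+ j)) wn) normfV normr_nat.
by rewrite expr2 -mulrA mulKf.
Qed.

(** Parseval at each point reduces the sum to translates of [v], which all have the energy of
    [v]. *)
Lemma sum_energy_spart v : ucontC v -> \sum_(m < n) energy (spart v m) = energy v.
Proof.
move=> uv; have un j : ucont (fun x => nsq (v (x + t *+ j))).
  by apply: ucont_nsq; exact: ucontC_shift.
have um (m : 'I_n) : ucont (fun x => nsq (spart v m x)) by apply/ucont_nsq/ucontC_spart.
rewrite /energy -(mean_sum tbX _ um).
under eq_fun do rewrite sum_nsq_spart.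
rewrite meanZ//; last exact: ucont_sum.
rewrite mean_sum//; under eq_bigr do rewrite (mean_shift tbX (t *+ _) (ucont_nsq uv)).
rewrite sumr_const card_ord -[X in _ * X]mulr_natl mulKf//.
by rewrite pnatr_eq0 -lt0n (prim_order_gt0 wn).
Qed.

Lemma convol_spart k v m : ucont k -> ucontC v -> convol k (spart v m) = spart (convol k v) m.
Proof.
move=> uk uv; apply/funext => x; have us j : ucontC (fun x => (w ^+ (j * m))^-1 * v (x + t *+ j)).
  by apply: ucontCZ; exact: ucontC_shift.
rewrite /spart convZ//; last exact: ucontC_sum.
rewrite (conv_sum uk _ _ (fun j : 'I_n => us j)); congr (_ * _).
by apply: eq_bigr => j _; rewrite convZ ?conv_shift//; exact: ucontC_shift.
Qed.

(** Splitting commutes with all translations, so the errors for translations treated earlier are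
    distributed among the parts without growing in total. *)
Lemma spart_shiftB v m s z x :
  spart v m (x + s) - z * spart v m x = spart (fun y => v (y + s) - z * v y) m x.
Proof.
rewrite /spart mulrCA -mulrBr; congr (_ * _); rewrite mulr_sumr -sumrB.
by apply: eq_bigr => j _; rewrite mulrBr [z * (_ * _)]mulrCA [x + s + _]addrAC.
Qed.

(** The difference telescopes, and since [w ^+ n = 1] only the terms at [0] and [n] remain, divided
    by [n]. *)
Lemma spart_eigen v m x :
  spart v m (x + t) - w ^+ m * spart v m x = (w ^+ m / n%:R) * (v (x + t *+ n) - v x).
Proof.
rewrite /spart mulrCA -mulrBr [w ^+ m / _]mulrC -mulrA; congr (_ * _).
have wV i : w ^+ i != 0 by rewrite expf_neq0// (prim_root_eq0 wn) -lt0n (prim_order_gt0 wn).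
pose F j := w ^+ m * ((w ^+ (j * m))^-1 * v (x + t *+ j)).
have -> : \sum_(j < n) (w ^+ (j * m))^-1 * v (x + t + t *+ j) = \sum_(j < n) F j.+1.
  apply: eq_bigr => j _; rewrite /F mulSn exprD invfM mulrA (mulrA (w ^+ m)) divff// mul1r.
  by rewrite mulrS addrA.
rewrite mulr_sumr -(@big_mkord _ _ _ n xpredT (fun j => F j.+1)) -(@big_mkord _ _ _ n xpredT F).
rewrite -sumrB telescope_sumr// /F exprM (prim_expr_order wn) expr1n.
by rewrite mul0n expr0 invr1 !mul1r mulr0n addr0 mulrBr.
Qed.

Lemma sum_energy_eigen v : ucontC v ->
  \sum_(m < n) energy (fun x => spart v m (x + t) - w ^+ m * spart v m x)
  <= 4 / n%:R * energy v.
Proof.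
move=> uv; have nR : 0 < n%:R :> R by rewrite ltr0n (prim_order_gt0 wn).
have ut : ucontC (fun x => v (x + t *+ n)) by exact: ucontC_shift.
rewrite (@le_trans _ _ (\sum_(m < n) 4 / n%:R ^+ 2 * energy v))//.
  apply: ler_sum => m _; under [X in energy X]eq_fun do rewrite spart_eigen.
  rewrite energyZ; last exact: ucontCB.
  have -> : nsq (w ^+ m / n%:R) = (n%:R ^+ 2)^-1.
    rewrite nsqM nsq_norm1 ?normrX ?(norm_prim_root wn) ?expr1n// mul1r.
    have -> : n%:R^-1 = (n%:R^-1 : R)%:C :> R[i] by rewrite fmorphV rmorph_nat.
    by rewrite nsq_real exprVn.
  rewrite [4 / _]mulrC -mulrA ler_wpM2l ?invr_ge0 ?sqr_ge0//.
  by have := energyB ut uv; rewrite energy_shift//; lra.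
rewrite sumr_const card_ord -[_ *+ n]mulr_natl mulrA le_eqVlt; apply/orP; left.
by apply/eqP; congr (_ * _); field; rewrite lt0r_neq0.
Qed.

End spectral_parts.

(** Induction on [F]. All energies in the inequality add up exactly over the spectral parts, and the
    new translation adds errors of total order [1 / n]; so for large [n] some part still satisfies
    the strict inequality. *)
Lemma approx_eigenfunction k v0 eps (F : seq X) (c : R) :
  ucont k -> ucontC v0 -> 0 <= c -> uniq F ->
  eps * energy v0 < energy (convol k v0) ->
  exists z v, [/\ ucontC v, forall t, `|z t| = 1 &
    eps * energy v + c * \sum_(t <- F) energy (fun x => v (x + t) - z t * v x)
    < energy (convol k v)].
Proof.
move=> uk uv0 c0 + Hv0; elim: F => [_|t F IH /=/andP[tF uF]].
  by exists (fun=> 1), v0; split=> // [t|]; rewrite ?normr1// big_nil mulr0 addr0.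
have [z [v [uv z1 Hv]]] := IH uF.
pose D := energy (convol k v) - (eps * energy v +
  c * \sum_(s <- F) energy (fun x => v (x + s) - z s * v x)).
have D0 : 0 < D by rewrite subr_gt0.
(* So large that the new errors, at most [4 / n%:R * energy v] in total, cost less than the surplus
   [D]. *)
pose n := (Num.truncn (c * (4 * energy v) / D)).+1.
have nR : 0 < n%:R :> R by rewrite ltr0n.
have [w wn] := prim_root_exists R[i] (isT : 0 < n)%N.
have us m : ucontC (spart n w t v m) by exact: ucontC_spart.
have ud (z' : X -> R[i]) s u : ucontC u -> ucontC (fun x => u (x + s) - z' s * u x).
  by move=> uu; apply: ucontCB; [exact: ucontC_shift|exact: ucontCZ].
pose Q (m : 'I_n) := energy (convol k (spart n w t v m)) - (eps * energy (spart n w t v m) +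
  c * (\sum_(s <- F) energy (fun x => spart n w t v m (x + s) - z s * spart n w t v m x)) +
  c * energy (fun x => spart n w t v m (x + t) - w ^+ m * spart n w t v m x)).
have Qpos : 0 < \sum_m Q m.
  have cn : c * \sum_(m < n) energy (fun x =>
      spart n w t v m (x + t) - w ^+ m * spart n w t v m x) < D.
    rewrite (le_lt_trans (ler_wpM2l c0 (sum_energy_eigen t wn uv)))//.
    have -> : c * (4 / n%:R * energy v) = c * (4 * energy v) / n%:R by field; rewrite lt0r_neq0.
    by rewrite ltr_pdivrMr// -ltr_pdivrMl// [X in X < _]mulrC; exact: truncnS_gt.
  rewrite sumrB !big_split/= -!mulr_sumr exchange_big/=.
  under eq_bigr do rewrite convol_spart//.
  under [X in _ - (_ + c * X + _)]eq_bigr => s _.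
    under eq_bigr do under [X in energy X]eq_fun do rewrite spart_shiftB.
    rewrite sum_energy_spart//; last exact: ud.
    over.
  rewrite (sum_energy_spart t wn uv) (sum_energy_spart t wn (ucontC_conv uk uv)).
  by rewrite opprD addrA subr_gt0; exact: cn.
have [m Qm] : exists m, 0 < Q m.
  apply/not_existsP => nQ; move: Qpos; rewrite ltNge => /negP; apply.
  by apply: sumr_le0 => m _; rewrite leNgt; apply/negP/nQ.
(* The old eigenvalues survive on [F], which does not contain [t]. *)
exists (fun s => if s == t then w ^+ m else z s), (spart n w t v m); split=> // [s|].
  by case: eqP => // _; rewrite normrX (norm_prim_root wn) expr1n.
rewrite big_cons eqxx mulrDr addrCA [X in _ + X]addrC.
rewrite (eq_big_seq (fun s => energy (fun x => spart n w t v m (x + s) - z s * spart n w t v m x))).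
  by move: Qm; rewrite /Q; lra.
by move=> s sF; case: eqP => // st; rewrite -st sF in tF.
Qed.

(** * From approximate eigenvalues to approximate characters *)

Section approximate_characters.
Variables (k : X -> R) (x0 : X).
Hypotheses (uk : ucont k) (kx0 : k (- x0) != k 0).

Let l y := k y - k (y - x0).

Let ul : ucont l.
Proof. by apply: ucontB => //; exact: ucont_shift. Qed.

(** The squared [L^2] distance from [l] to its translate; by [energy_conv] it bounds how far
    translating the kernel moves the operator. *)
Definition kshift t : R := mean (fun y => (l (y + t) - l y) ^+ 2).

Lemma kshift_small e : 0 < e -> \forall t \near (0 : X), kshift t <= e.
Proof.
move=> e0; pose d := Num.min 1 e; have d0 : 0 < d by rewrite lt_min ltr01.
apply: filterS (ul d0) => t lt; rewrite -[leRHS](mean_cst X).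
have u2 : ucont (fun y => (l (y + t) - l y) ^+ 2).
  by apply: ucontM => //; apply: ucontB => //; exact: ucont_shift.
apply: ler_mean => [//|//||y]; first exact: ucont_cst.
have := lt y; rewrite le_min => /andP[h1 he].
by rewrite -real_normK ?num_real// expr2 (le_trans _ he)// ler_piMl.
Qed.

Let l0 : exists2 v, ucontC v & 0 < energy (convol l v).
Proof.
(* Convolving [l] with itself gives the mean of [l ^+ 2] at [0], which is positive because
   [l 0 = k 0 - k (- x0)] is nonzero. *)
have lC : ucontC (fun x => (l x)%:C) by split => //=; exact: ucont_cst.
exists (fun x => (l x)%:C) => //; apply: (mean_gt0 tbX (a := 0)).
- exact/ucont_nsq/ucontC_conv.
- by move=> x; exact: nsq_ge0.
have l2 : 0 < mean (fun y => l y ^+ 2).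
  apply: (mean_gt0 tbX (a := 0)); first exact: ucontM.
    by move=> x; exact: sqr_ge0.
  by rewrite lt_neqAle sqr_ge0 eq_sym sqrf_eq0 subr_eq0 sub0r eq_sym kx0.
rewrite /nsq/= ltr_pwDl ?sqr_ge0// exprn_gt0//.
by under eq_fun do rewrite subr0 -expr2.
Qed.

(** Multiplicativity compares translating [v] by [s] and then [t] with translating by [s + t].
    Continuity at [0] comes from moving a translation from [v] to the kernel. For nontriviality,
    convolution with [l] is [1 - z x0] times convolution with [k], up to an eigenvalue error. The
    constant [e] must not depend on [F] and [d], which vary in the later limit. *)
Lemma approx_character : exists e, 0 < e /\ forall (F : seq X) (d : R), 0 < d ->
  exists z : X -> R[i], [/\ forall t, `|z t| = 1,
    {in F &, forall s t, nsq (z (s + t) - z s * z t) <= d},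
    {in F, forall t, e * nsq (z t - 1) <= 2 * kshift t + d} &
    e <= nsq (z x0 - 1) + d].
Proof.
have [v0 uv0 N0] := l0.
have A0 := energy_ge0 uv0; have A1 : 0 < energy v0 + 1 by rewrite ltr_wpDl.
(* The added 1 makes the next inequality strict. *)
pose eps := energy (convol l v0) / (energy v0 + 1).
have eps0 : 0 < eps by rewrite divr_gt0.
have Heps : eps * energy v0 < energy (convol l v0).
  by rewrite /eps mulrAC ltr_pdivrMr// ltr_pM2l// ltrDl.
have mean_sqr_ge0 (f : X -> R) : ucont f -> 0 <= mean (fun y => f y ^+ 2).
  by move=> uf; apply: mean_ge0 => [//||y]; [exact: ucontM|exact: sqr_ge0].
pose K := mean (fun y => l y ^+ 2); pose Kk := mean (fun y => k y ^+ 2).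
have K0 : 0 <= K by exact: mean_sqr_ge0.
have Kk0 : 0 <= Kk by exact: mean_sqr_ge0.
have Kk1 : 0 < 2 * Kk + 1 by rewrite ltr_wpDl// mulr_ge0.
exists (eps / (2 * Kk + 1)); split=> [|F d d0]; first exact: divr_gt0.
have K10 : 0 < 10 + 2 * K by rewrite ltr_pwDl// mulr_ge0.
have K1 : 0 < K + 1 by rewrite ltr_wpDl.
(* Here 10 is [2 * (2 + 2) + 2], from three eigenvalue errors combined by [energyD] and [energyB];
   [2 * K] pays for an error sent through the convolution. *)
pose eta := d / (10 + 2 * K); have eta0 : 0 < eta by rewrite divr_gt0.
have etad : eta * (10 + 2 * K) = d by rewrite /eta divfK// lt0r_neq0.
(* As [energy (convol l v)] is at most [K * A], this weight keeps each error on [F'] below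
   [eta * A]. *)
pose c := (K + 1) / eta; have c0 : 0 < c by rewrite divr_gt0.
have c_eta : c * eta = K + 1 by rewrite /c divfK// lt0r_neq0.
pose F' := undup (x0 :: F ++ [seq s + t | s <- F, t <- F]).
have [z [v [uv z1 Hv]]] := approx_eigenfunction ul uv0 (ltW c0) (undup_uniq _ : uniq F') Heps.
have ushift t : ucontC (fun x => v (x + t)) by exact: ucontC_shift.
have ud t : ucontC (fun x => v (x + t) - z t * v x) by apply: ucontCB => //; exact: ucontCZ.
have vA := energy_ge0 uv; set A := energy v in vA Hv.
have KA := energy_conv ul uv; rewrite -/K -/A in KA.
have sum0 : 0 <= \sum_(t <- F') energy (fun x => v (x + t) - z t * v x).
  by rewrite sumr_ge0// => t _; exact: energy_ge0.
have Dle t : t \in F' -> energy (fun x => v (x + t) - z t * v x) <= eta * A.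
  move=> tF; rewrite -(ler_pM2l c0) mulrA c_eta.
  have : energy (fun x => v (x + t) - z t * v x) <=
      \sum_(t <- F') energy (fun x => v (x + t) - z t * v x).
    by rewrite (big_rem t)//= lerDl sumr_ge0// => s _; exact: energy_ge0.
  move=> /(ler_wpM2l (ltW c0)); have := mulr_ge0 (ltW eps0) vA.
  by rewrite mulrDl mul1r; lra.
have {sum0} epsA : eps * A < energy (convol l v).
  by apply: le_lt_trans Hv; rewrite lerDl mulr_ge0// ltW.
have {vA} Apos : 0 < A.
  rewrite lt_neqAle vA andbT eq_sym; apply/eqP => A_0.
  by move: (lt_le_trans epsA KA); rewrite A_0 !mulr0 ltxx.
have etaA := ltW (mulr_gt0 eta0 Apos).
have inF t : t \in F -> t \in F' by rewrite mem_undup inE mem_cat => ->; rewrite orbT.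
exists z; split=> //.
- move=> s t sF tF; rewrite -(ler_pM2r Apos) -energyZ//.
  have stF : s + t \in F'.
    by rewrite mem_undup inE mem_cat allpairs_f ?orbT.
  have ua : ucontC (fun x => z t * (v (x + s) - z s * v x)) by exact: ucontCZ.
  have ub : ucontC (fun x => v (x + s + t) - z t * v (x + s)).
    exact: (ucontC_shift s (ud t)).
  have -> : (fun x => (z (s + t) - z s * z t) * v x) = (fun x =>
      ((v (x + s + t) - z t * v (x + s)) + z t * (v (x + s) - z s * v x)) -
      (v (x + (s + t)) - z (s + t) * v x)).
    by apply/funext => x; rewrite addrA; ring.
  have := energyB (ucontCD ub ua) (ud (s + t)); have := energyD ub ua.
  rewrite energyZ// nsq_norm1// mul1r.
  have -> : energy (fun x => v (x + s + t) - z t * v (x + s)) =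
      energy (fun x => v (x + t) - z t * v x).
    by rewrite -(energy_shift s (ud t)); congr energy; apply/funext => x; rewrite addrAC.
  have := Dle _ (inF _ sF); have := Dle _ (inF _ tF); have := Dle _ stF.
  have -> : d * A = 10 * (eta * A) + 2 * K * (eta * A) by rewrite -etad; ring.
  have := mulr_ge0 K0 etaA; lra.
- move=> t tF; have uL := ucontC_conv ul uv.
  have uk' : ucont (fun y => l (y - t) - l y) by apply: ucontB => //; exact: ucont_shift.
  have : nsq (z t - 1) * energy (convol l v) <= 2 * (kshift t * A) + 2 * (K * (eta * A)).
    rewrite -energyZ//.
    have -> : (fun x => (z t - 1) * convol l v x) = (fun x =>
        convol (fun y => l (y - t) - l y) v x - convol l (fun x => v (x + t) - z t * v x) x).
      apply/funext => x; rewrite convBl//; last exact: ucont_shift.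
      rewrite conv_kernel_shift -mulN1r.
      have -> : (fun x => v (x + t) - z t * v x) = (fun x => v (x + t) + (- z t) * v x).
        by apply/funext => y; rewrite mulNr.
      rewrite convD//; last exact: ucontCZ.
      by rewrite conv_shift// convZ//; ring.
    apply: le_trans (energyB _ _) _; try exact: ucontC_conv.
    rewrite lerD// ler_wpM2l//.
      have -> : kshift t = mean (fun y => (l (y - t) - l y) ^+ 2).
        have u2 : ucont (fun y => (l (y - t) - l y) ^+ 2) by exact: ucontM.
        rewrite -(mean_shift tbX t u2) /kshift; congr mean; apply/funext => y.
        by rewrite addrK -sqrrN opprB.
      exact: energy_conv.
    by rewrite (le_trans (energy_conv ul (ud t)))// ler_wpM2l// Dle// inF.
  move=> h; rewrite -(ler_pM2r Apos).
  have e_eps : eps / (2 * Kk + 1) <= eps.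
    by rewrite ler_pdivrMr// ler_peMr// ?(ltW eps0)// lerDr mulr_ge0.
  have h2 : eps / (2 * Kk + 1) * nsq (z t - 1) * A <= nsq (z t - 1) * energy (convol l v).
    rewrite mulrAC mulrC ler_wpM2l ?nsq_ge0// (le_trans _ (ltW epsA))//.
    by rewrite ler_wpM2r// ltW.
  have -> : (2 * kshift t + d) * A = 2 * (kshift t * A) + (10 * (eta * A) + 2 * (K * (eta * A))).
    by rewrite -etad; ring.
  by move: h h2 etaA; lra.
have x0F : x0 \in F' by rewrite mem_undup inE eqxx.
rewrite ler_pdivrMr// -(ler_pM2r Apos).
have uC := ucontC_conv uk uv.
have h : energy (convol l v) <= 2 * (nsq (z x0 - 1) * energy (convol k v)) + 2 * (Kk * (eta * A)).
  have -> : convol l v = (fun x =>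
      (1 - z x0) * convol k v x - convol k (fun x => v (x + x0) - z x0 * v x) x).
    apply/funext => x; rewrite convBl//; last exact: ucont_shift.
    rewrite conv_kernel_shift.
    have -> : (fun x => v (x + x0) - z x0 * v x) = (fun x => v (x + x0) + (- z x0) * v x).
      by apply/funext => y; rewrite mulNr.
    rewrite convD//; last exact: ucontCZ.
    by rewrite conv_shift// convZ//; ring.
  apply: le_trans (energyB _ _) _; [exact: ucontCZ|exact: ucontC_conv|].
  rewrite lerD// ler_wpM2l//.
    by rewrite energyZ// -nsqN opprB.
  by rewrite (le_trans (energy_conv uk (ud x0)))// ler_wpM2l// Dle.
have h2 := ler_wpM2l (nsq_ge0 (z x0 - 1)) (energy_conv uk uv); rewrite -/Kk -/A in h2.
have h3 : eta <= d by rewrite -etad ler_peMr// ?(ltW eta0)//; lra.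
have h4 : Kk * (eta * A) <= Kk * (d * A) by rewrite !ler_wpM2l// ler_wpM2r// ltW.
have h5 := mulr_gt0 d0 Apos; have h6 := mulr_ge0 (nsq_ge0 (z x0 - 1)) (ltW Apos).
have -> : (nsq (z x0 - 1) + d) * (2 * Kk + 1) * A =
  2 * (nsq (z x0 - 1) * (Kk * A)) + 2 * (Kk * (d * A)) + nsq (z x0 - 1) * A + d * A by ring.
by move: epsA h h2 h4 h5 h6; lra.
Qed.

End approximate_characters.

End approximate_eigenfunctions.

(** * Continuous characters *)

Lemma ultra_fmap (S T : Type) (f : S -> T) (U : set_system S) :
  UltraFilter U -> UltraFilter (f @ U).
Proof.
move=> UU; split=> [|G PG fUG]; first exact: fmap_proper_filter.
apply/seteqP; split=> A; last exact: fUG.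
move=> GA; have [//|UnA] := in_ultra_setVsetC (f @^-1` A) UU.
have /fUG GnA : (f @ U) (~` A) by [].
by case: (@filter_not_empty _ G _); rewrite -(setICr A); exact: filterI.
Qed.

Section characters.
Local Open Scope complex_scope.
Local Notation Re := complex.Re.
Local Notation Im := complex.Im.
Variable R : realType.

Lemma circleE (z : R[i]) : (circle R z) = (nsq z = 1).
Proof.
rewrite propeqE /circle/=; split=> [/nsq_norm1//|z1].
by apply/eqP; rewrite -(@pexpr_eq1 _ _ 2)// -nsqE z1.
Qed.

Lemma norm_lt_nsq (z : R[i]) (e : R) : 0 < e -> (`|z| < e%:C) = (nsq z < e ^+ 2).
Proof.
move=> e0; rewrite -(ltr_pXn2r (isT : (0 < 2)%N)) ?nnegrE// ?lecR ?(ltW e0)//.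
by rewrite -nsqE -rmorphXn ltcR.
Qed.

Section group_characters.
Variables (G : zmodType) (nu : Topological G).
Hypothesis gt : group_topology nu.

Lemma nbhs_translate (x : G) (V : set G) : @nbhs _ (tspace nu) 0 V ->
  @nbhs _ (tspace nu) x [set y | V (y - x)].
Proof.
case: gt => addc oppc V0.
have := addc (x, - x) V; rewrite /= subrr => /(_ V0)[[A B] /= [Ax Bx] AB].
apply: filterS Ax => y Ay; apply: (AB (y, - x)); split => //.
exact: (@nbhs_singleton (tspace nu) _ _ Bx).
Qed.

Lemma dual_near1 (chi : G -> R[i]) (e : R) : dual R nu chi -> 0 < e ->
  @nbhs _ (tspace nu) 0 [set t | nsq (chi t - 1) < e].
Proof.
case=> chi_circle chiD chi_cont e0.
have chi0 : chi 0 = 1.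
  have c0 : chi 0 != 0.
    have : circle R (chi 0) by apply: chi_circle; exists 0.
    by rewrite /circle/= -normr_eq0 => ->; rewrite oner_eq0.
  by apply: (mulIf c0); rewrite -chiD mul1r addr0.
have se0 : 0 < Num.sqrt e by rewrite sqrtr_gt0.
have se0' : 0 < (Num.sqrt e)%:C by rewrite ltcR.
have /cvgrPdist_lt/(_ _ se0') := chi_cont 0.
by apply: filterS => t /=; rewrite chi0 distrC norm_lt_nsq// sqr_sqrtr// ltW.
Qed.

(** Continuity at [0] suffices, because [chi x - chi y] has the modulus of [chi (y - x) - 1]. *)
Lemma near1_dual (chi : G -> R[i]) : (forall x, circle R (chi x)) ->
  {morph chi : x y / x + y >-> x * y} ->
  (forall e : R, 0 < e -> @nbhs _ (tspace nu) 0 [set t | nsq (chi t - 1) < e]) ->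
  dual R nu chi.
Proof.
move=> chi_circle chiD chi1; split=> //; first by move=> _ [x _ <-].
move=> x; apply/cvgrPdist_lt => -[e i]; rewrite ltcE/= => /andP[/eqP -> e0].
have := nbhs_translate x (chi1 (e ^+ 2) (exprn_gt0 2 e0)).
apply: filterS => y /=; rewrite norm_lt_nsq//.
have -> : chi x - chi y = - ((chi (y - x) - 1) * chi x).
  by rewrite mulrBl -chiD subrK mul1r opprB.
by rewrite nsqN nsqM; have := chi_circle x; rewrite circleE => ->; rewrite mulr1.
Qed.

End group_characters.

Section separation.
Variable X : topologicalZmodType.
Hypothesis tbX : totally_bounded X.
Variables (k : X -> R) (x0 : X).
Hypotheses (uk : ucont k) (kx0 : k (- x0) != k 0).

(** The sets of approximate characters for growing [F] and shrinking [d] form a filter base. Along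
    an ultrafilter the real and imaginary parts converge, since they lie in a compact interval, and
    the defining inequalities are closed. *)
Lemma character_separation : exists chi : X -> R[i],
  [/\ forall x, circle R (chi x), {morph chi : x y / x + y >-> x * y},
    forall e : R, 0 < e -> \forall t \near (0 : X), nsq (chi t - 1) < e & chi x0 != 1].
Proof.
have [e [e0 approx]] := approx_character tbX uk kx0.
pose B (Fd : seq X * R) := [set z : X -> R[i] | [/\ forall t, `|z t| = 1,
  {in Fd.1 &, forall s t, nsq (z (s + t) - z s * z t) <= Fd.2},
  {in Fd.1, forall t, e * nsq (z t - 1) <= 2 * kshift k x0 t + Fd.2} &
  e <= nsq (z x0 - 1) + Fd.2]].
pose D := [set Fd : seq X * R | 0 < Fd.2].
have PB : ProperFilter (filter_from D B).
  apply: filter_from_proper => [|[F d] /= d0]; last by have [z zP] := approx F d d0; exists z.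
  apply: filter_from_filter; first by exists ([::], 1); exact: ltr01.
  move=> [F d] [F' d'] /= d0 d'0; exists (F ++ F', Num.min d d'); first by rewrite /D/= lt_min d0.
  move=> z [/= z1 zM zc zx].
  have memF t : t \in F -> t \in F ++ F' by rewrite mem_cat => ->.
  have memF' t : t \in F' -> t \in F ++ F' by rewrite mem_cat orbC => ->.
  have md : Num.min d d' <= d by rewrite ge_min lexx.
  have md' : Num.min d d' <= d' by rewrite ge_min lexx orbT.
  split; split=> //=.
  - by move=> s t /memF sF /memF tF; exact: le_trans (zM _ _ sF tF) _.
  - by move=> t /memF tF; rewrite (le_trans (zc _ tF))// lerD2l.
  - by rewrite (le_trans zx)// lerD2l.
  - by move=> s t /memF' sF /memF' tF; exact: le_trans (zM _ _ sF tF) _.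
  - by move=> t /memF' tF; rewrite (le_trans (zc _ tF))// lerD2l.
  - by rewrite (le_trans zx)// lerD2l.
have [U [UU BU]] := ultraFilterLemma PB.
have BinU Fd : 0 < Fd.2 -> U (B Fd) by move=> ?; apply: BU; exists Fd.
have lim1 (f : (X -> R[i]) -> R) : (forall z, B ([::], 1) z -> `|f z| <= 1) ->
    exists l : R, f @ U --> l.
  move=> f1; have := @segment_compact R (-1) 1; rewrite compact_ultra => cpt.
  have fU : U (f @^-1` `[-1, 1]).
    apply: filterS (BinU ([::], 1) ltr01) => z /f1.
    by rewrite /= in_itv/= ler_norml.
  by have [l [_ fl]] := cpt (f @ U) (ultra_fmap f UU) fU; exists l.
have sqr_le1 (r : R) : r ^+ 2 <= 1 -> `|r| <= 1.
  move=> r2; rewrite -(ler_pXn2r (isT : (0 < 2)%N)) ?nnegrE//.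
  by rewrite expr1n real_normK ?num_real.
have Re1 (z : R[i]) : `|z| = 1 -> `|Re z| <= 1.
  by move=> /nsq_norm1 z1; apply: sqr_le1; rewrite -z1 lerDl sqr_ge0.
have Im1 (z : R[i]) : `|z| = 1 -> `|Im z| <= 1.
  by move=> /nsq_norm1 z1; apply: sqr_le1; rewrite -z1 lerDr sqr_ge0.
have /choice[a aP] : forall t, exists l : R, (fun z => Re (z t)) @ U --> l.
  move=> t;  apply: lim1 => z [/= z1 _ _ _]; exact: Re1.
have /choice[b bP] : forall t, exists l : R, (fun z => Im (z t)) @ U --> l.
  move=> t;  apply: lim1 => z [/= z1 _ _ _]; exact: Im1.
pose chi t := a t +i* b t.
have cvg_nsq (p : (X -> R[i]) -> R[i]) (l : R[i]) :
    (fun z => Re (p z)) @ U --> Re l -> (fun z => Im (p z)) @ U --> Im l ->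
    (fun z => nsq (p z)) @ U --> nsq l.
  by move=> pa pb; apply: cvgD; rewrite expr2; apply: cvgM.
have chi_le (p : (X -> R[i]) -> R[i]) (l : R[i]) c d : 0 < d ->
    (fun z => Re (p z)) @ U --> Re l -> (fun z => Im (p z)) @ U --> Im l ->
    U [set z | c * nsq (p z) <= d] -> c * nsq l <= d.
  move=> d0 pa pb pd.
  apply: (@closed_cvg _ _ U _ (fun z => c * nsq (p z)) (fun x => x <= d)) => //.
  by apply: cvgM; [exact: cvg_cst|exact: cvg_nsq].
have chi1 t : nsq (chi t) = 1.
  have : (fun z => nsq (z t)) @ U --> nsq (chi t) by apply: cvg_nsq; [exact: aP|exact: bP].
  move=> /cvg_lim <-//; apply: lim_near_cst => //.
  by apply: filterS (BinU ([::], 1) ltr01) => z [/= z1 _ _ _]; rewrite nsq_norm1.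
exists chi; split.
- by move=> x; rewrite circleE.
- move=> s t; apply/eqP; rewrite -subr_eq0.
  suff : nsq (chi (s + t) - chi s * chi t) <= 0.
    by move=> /nsq_le0 ->.
  apply/ler_addgt0Pl => d d0; rewrite addr0 -[nsq _]mul1r.
  apply: (chi_le (fun z => z (s + t) - z s * z t)) => //.
  + have E z : Re (z (s + t) - z s * z t) =
        Re (z (s + t)) - (Re (z s) * Re (z t) - Im (z s) * Im (z t)).
      by case: (z s) (z t) (z (s + t)) => ? ? [? ?] [? ?].
    under eq_fun do rewrite E; rewrite E.
    by apply: cvgB; [exact: aP|apply: cvgB; apply: cvgM; (exact: aP || exact: bP)].
  + have E z : Im (z (s + t) - z s * z t) =
        Im (z (s + t)) - (Re (z s) * Im (z t) + Im (z s) * Re (z t)).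
      by case: (z s) (z t) (z (s + t)) => ? ? [? ?] [? ?].
    under eq_fun do rewrite E; rewrite E.
    by apply: cvgB; [exact: bP|apply: cvgD; apply: cvgM; (exact: aP || exact: bP)].
  + apply: filterS (BinU ([:: s; t], d) d0) => z [/= _ zM _ _].
    by rewrite mul1r zM// !inE eqxx ?orbT.
(* The two error terms add up to three quarters of [e * c], which leaves the conclusion strict. *)
- move=> c c0; have ec0 : 0 < e * c / 4 by rewrite divr_gt0// mulr_gt0.
  have := kshift_small tbX x0 uk ec0; apply: filterS => t kt.
  suff h : e * nsq (chi t - 1) <= 2 * (e * c / 4) + e * c / 4.
    rewrite -(ltr_pM2l e0); have := mulr_gt0 e0 c0; lra.
  apply: (chi_le (fun z => z t - 1)) => //; first lra.
  + by under eq_fun do rewrite raddfB/=; apply: cvgB; [exact: aP|exact: cvg_cst].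
  + by under eq_fun do rewrite raddfB/=; apply: cvgB; [exact: bP|exact: cvg_cst].
  + apply: filterS (BinU ([:: t], e * c / 4) ec0) => z [/= _ _ zc _].
    by rewrite (le_trans (zc t _)) ?inE// lerD2r ler_wpM2l.
(* If [chi x0 = 1], the limit of the last estimate gives [e <= d] for every positive [d]. *)
- apply/eqP => chix.
  suff : e <= 0 by rewrite leNgt e0.
  have : (fun z => nsq (z x0 - 1)) @ U --> nsq (chi x0 - 1).
    by apply: cvg_nsq; under eq_fun do rewrite raddfB/=; apply: cvgB;
      (exact: aP || exact: bP || exact: cvg_cst).
  rewrite chix subrr => H; apply/ler_addgt0Pl => d d0.
  have -> : d + 0 = nsq (0 : R[i]) + d by rewrite /nsq/= expr0n !addr0 add0r.
  apply: (@closed_cvg _ _ U _ (fun z => nsq (z x0 - 1) + d) (fun x => e <= x)).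
  + exact: closed_ge.
  + by apply: filterS (BinU ([::], d) d0) => z [].
  + by apply: cvgD => //; exact: cvg_cst.
Qed.

End separation.

End characters.

(** * Neighborhoods and compactness in topological abelian groups *)

Section topological_zmodule.
Variable X : topologicalZmodType.
Implicit Types (U V W : set X) (x y : X).

Lemma nbhs0_shift x U : nbhs 0 U -> nbhs x [set y | U (y - x)].
Proof.
move=> U0; have := @sub_continuous X (x, x) U; rewrite /= subrr => /(_ U0)[[A B] /= [Ax Bx] AB].
by apply: filterS Ax => y Ay; apply: (AB (y, x)); split => //; exact: nbhs_singleton Bx.
Qed.

Lemma nbhs_shift0 x U : nbhs x U -> nbhs 0 [set u | U (x + u)].
Proof.
move=> Ux; have := @add_continuous X (x, 0) U; rewrite /= addr0 => /(_ Ux)[[A B] /= [Ax B0] AB].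
by apply: filterS B0 => u Bu; apply: (AB (x, u)); split => //; exact: nbhs_singleton Ax.
Qed.

Lemma nbhs0_splitD U : nbhs 0 U -> exists2 V, nbhs 0 V & forall x y, V x -> V y -> U (x + y).
Proof.
move=> U0; have := @add_continuous X (0, 0) U; rewrite /= addr0 => /(_ U0)[[A B] /= [A0 B0] AB].
exists (A `&` B); first exact: filterI.
by move=> x y [Ax _] [_ By]; apply: (AB (x, y)).
Qed.

Lemma nbhs0_splitB U : nbhs 0 U -> exists2 V, nbhs 0 V & forall x y, V x -> V y -> U (x - y).
Proof.
move=> U0; have := @sub_continuous X (0, 0) U; rewrite /= subr0 => /(_ U0)[[A B] /= [A0 B0] AB].
exists (A `&` B); first exact: filterI.
by move=> x y [Ax _] [_ By]; apply: (AB (x, y)).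
Qed.

Lemma nbhs0N U : nbhs 0 U -> nbhs 0 [set x | U (- x)].
Proof.
move=> /nbhs0_splitB[V V0 VU]; apply: filterS (V0) => x Vx /=.
by rewrite -sub0r; apply: VU => //; exact: nbhs_singleton.
Qed.

Hypothesis cX : compact [set: X].

Lemma compact_totally_bounded : totally_bounded X.
Proof.
move=> U U0.
(* Finite sequences growing by inclusion: near-covering compactness along this filter replaces the
   extraction of a finite subcover. *)
pose F := filter_from [set: seq X] (fun s => [set s' : seq X | {subset s <= s'}]).
have FF : Filter F.
  apply: filter_from_filter; first by exists [::].
  by move=> s t _ _; exists (s ++ t) => // r st; split=> a ar; apply: st; rewrite mem_cat ar ?orbT.
have [|s _ sP] := (compact_near_coveringP _).1 cX _ F (fun s x => exists2 a, a \in s & U (x + a)).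
  move=> x _; exists ([set y | U (y - x)], [set s : seq X | - x \in s]) => /=.
    split; first exact: nbhs0_shift.
    by exists [:: - x] => // s /(_ (- x)); apply; rewrite inE.
  by move=> [y s] [/= Uy xs]; exists (- x).
by exists s => x; apply: sP.
Qed.

Variable R : realType.

Lemma compact_ucont (f : X -> R) : continuous f -> ucont f.
Proof.
move=> fc e e0; have e20 : 0 < e / 2 by rewrite divr_gt0.
pose P u x := `|f (x + u) - f x| <= e.
have UP : \forall u \near (0 : X), [set: X] `<=` P u.
  apply: ((compact_near_coveringP _).1 cX) => x _; have /cvgrPdist_lt/(_ _ e20) fx := fc x.
  have /nbhs0_splitD[V V0 VU] := nbhs_shift0 fx.
  exists ([set y | V (y - x)], V); first by split=> //; exact: nbhs0_shift.
  move=> [y u] [/= Vy Vu]; rewrite /P.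
  have h1 : `|f x - f y| < e / 2.
    by have /= := VU _ 0 Vy (nbhs_singleton V0); rewrite addr0 [x + _]addrC subrK.
  have h2 : `|f x - f (y + u)| < e / 2.
    by have /= := VU _ _ Vy Vu; rewrite addrA [x + _]addrC subrK.
  rewrite -(subrKA (f x)) (le_trans (ler_normD _ _))// [leRHS]splitr.
  by rewrite lerD ?(ltW h1)// distrC ltW.
by apply: filterS UP => u uP x; exact: uP.
Qed.

End topological_zmodule.

Section circle_powers.
Variable R : realType.
Local Open Scope complex_scope.
Local Notation Re := complex.Re.

(** For [a = Re w] one has [1 - Re (w ^+ 2) = 2 * (1 - a) * (1 + a)]. If all powers had nonnegative
    real part, the distance of the real part from 1 would at least double with each squaring and
    finally exceed 1. *)
Lemma circle_no_small_subgroup (z : R[i]) : nsq z = 1 -> z != 1 -> exists m, Re (z ^+ m) < 0.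
Proof.
move=> z1 zN1; apply: contrapT => /forallNP noneg.
have Re_ge0 m : 0 <= Re (z ^+ m) by rewrite leNgt; apply/negP/noneg.
have nsqX m : nsq (z ^+ m) = 1.
  by elim: m => [|m IH]; rewrite ?expr0 ?exprS ?nsqM ?IH ?z1 ?mulr1// /nsq/= expr0n expr1n addr0.
have Re2 (w : R[i]) : nsq w = 1 -> Re (w ^+ 2) = 2 * Re w ^+ 2 - 1.
  by case: w => a b; rewrite /nsq/= expr2/=; lra.
have Re_lt1 : 0 < 1 - Re z.
  rewrite subr_gt0 lt_neqAle; apply/andP; split; last first.
    rewrite -(ler_pXn2r (isT : (0 < 2)%N)) ?nnegrE//; last by have := Re_ge0 1; rewrite expr1.
    by rewrite expr1n -z1 /nsq lerDl sqr_ge0.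
  apply: contra zN1 => /eqP Rez; move: z1; rewrite /nsq Rez expr1n => /eqP.
  by rewrite addrC -[X in _ == X]add0r (inj_eq (addIr _)) sqrf_eq0 eq_complex Rez eqxx.
have grow n : 2 ^+ n * (1 - Re z) <= 1 - Re (z ^+ (2 ^ n)).
  elim: n => [|n IH]; first by rewrite expn0 expr0 mul1r expr1.
  rewrite exprS -mulrA (le_trans (ler_wpM2l _ IH))// expnSr exprM Re2//.
  have := Re_ge0 (2 ^ n)%N; set a := Re _ => a0.
  have a1 : 0 <= 1 - a by rewrite (le_trans _ IH)// mulr_ge0 ?exprn_ge0 ?(ltW Re_lt1).
  have := mulr_ge0 a0 a1; lra.
pose n := Num.truncn (1 - Re z)^-1.
have : 2 ^+ n.+1 * (1 - Re z) <= 1.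
  by rewrite (le_trans (grow _))// gerBl.
rewrite leNgt => /negP; apply; rewrite -ltr_pdivrMr// div1r.
rewrite (lt_le_trans (truncnS_gt _))// -natrX ler_nat.
by rewrite ltnW// ltn_expl.
Qed.

End circle_powers.

(** * Local quasi-convexity of compact groups *)

Section compact_LQC.
Variables (R : realType) (X : topologicalZmodType).
Hypothesis cX : compact [set: X].
Local Open Scope complex_scope.
Local Notation Re := complex.Re.

Lemma topologicalZmod_group_topology : group_topology (Topological.class X).
Proof.
by split; [exact: (@add_continuous X)|exact: (@opp_continuous X)].
Qed.

(** The form in which a metric enters the construction of characters, through the distance to
    [0]. *)
Definition separated_by_functions : Prop :=
  forall x : X, x != 0 -> exists2 f : X -> R, continuous f & f x != f 0.

Hypothesis sX : separated_by_functions.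

Lemma compact_character_separation (x : X) : x != 0 ->
  exists2 chi, dual R (Topological.class X) chi & Re (chi x) < 0.
Proof.
(* Convolution kernels have to differ at [- x], hence the sign. *)
move=> x0; have [f fc fx] : exists2 f : X -> R, continuous f & f (- x) != f 0.
  by apply: sX; rewrite oppr_eq0.
have tb := compact_totally_bounded cX.
have [chi [chi_circle chiD chi1 chix]] :=
  character_separation tb (compact_ucont cX fc) fx.
have nsq1 y : nsq (chi y) = 1 by have := chi_circle y; rewrite circleE.
have [m Rem] := circle_no_small_subgroup (nsq1 x) chix.
have chi0 : chi 0 = 1.
  by apply: (mulIf (nsq1_neq0 (nsq1 0))); rewrite -chiD mul1r addr0.
have chiX y : chi (y *+ m) = chi y ^+ m.
  by elim: m {Rem} => [|m IH]; rewrite ?mulr0n// mulrS chiD IH exprS.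
exists (fun y => chi (y *+ m)); last by rewrite chiX.
apply: near1_dual; first exact: topologicalZmod_group_topology.
- by move=> y; exact: chi_circle.
- by move=> y z; rewrite mulrnDl chiD.
move=> e /chi1; have : (fun y : X => y *+ m) @ (0 : X) --> (0 : X); last exact.
elim: m {Rem chiX} => [|m IH]; first exact: cvg_cst.
have -> : (fun y : X => y *+ m.+1) = (fun y => y + y *+ m).
  by apply/funext => y; rewrite mulrS.
rewrite -[X in _ --> X](addr0 (0 : X)).
exact: (cvg_comp2 cvg_id IH (@add_continuous X (0, 0))).
Qed.

Lemma dual_Re_ge0_nbhs chi : dual R (Topological.class X) chi ->
  \forall x \near (0 : X), 0 <= Re (chi x).
Proof.
move=> chiX; have := dual_near1 chiX (@ltr01 R); apply: filterS => x /=.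
rewrite /nsq; case: (chi x) => a b/=; rewrite subr0 => h.
have : (a - 1) ^+ 2 < 1 by rewrite (le_lt_trans _ h)// lerDl sqr_ge0.
rewrite leNgt; apply: contraTN => a0; rewrite -leNgt.
have := sqr_ge0 a; have := a0; lra.
Qed.

(** A character with negative real part at a point has it nearby too, so by compactness finitely
    many characters detect every point outside [U]. The points where all of these have nonnegative
    real part form a polar, which is quasi-convex. *)
Lemma compact_quasi_convex_basis (U : set X) : nbhs 0 U ->
  exists V : set X, [/\ nbhs 0 V, quasi_convex R (Topological.class X) V & V `<=` U].
Proof.
move=> U0; pose D := [set s : seq (X -> R[i]) |
  forall chi, chi \in s -> dual R (Topological.class X) chi].
pose F := filter_from D (fun s => [set s' | D s' /\ {subset s <= s'}]).
have FF : Filter F.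
  apply: filter_from_filter; first by exists [::].
  move=> s t Ds Dt; exists (s ++ t).
    by move=> chi; rewrite mem_cat => /orP[/Ds|/Dt].
  by move=> r [Dr st]; split; split=> // a ar; apply: st; rewrite mem_cat ar ?orbT.
pose P (s : seq (X -> R[i])) x := U x \/ exists2 chi, chi \in s & Re (chi x) < 0.
have [s Ds sP] : \forall s \near F, [set: X] `<=` P s.
  apply: ((compact_near_coveringP _).1 cX) => x _.
  have [->|x0] := eqVneq x 0.
    exists (U, setT); first by split=> //; exact: filterT.
    by move=> [y s] [/= Uy _]; left.
  have [chi dchi chix] := compact_character_separation x0.
  exists ([set y | Re (chi y) < 0], [set s : seq (X -> R[i]) | chi \in s]).
    split=> /=; last first.
      exists [:: chi]; first by move=> c; rewrite inE => /eqP ->.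
      by move=> s [_ /(_ chi)]; rewrite inE eqxx; apply.
    (* Wherever [Re (chi y)] is nonnegative, [chi y] is at least [- Re (chi x)] away from [chi x];
       this fixes the radius. *)
    have chi_near := dual_near1 dchi (_ : 0 < Re (chi x) ^+ 2).
    have {}chi_near : \forall t \near (0 : X), nsq (chi t - 1) < Re (chi x) ^+ 2.
      by apply: chi_near; rewrite exprn_even_gt0//= lt_eqF.
    apply: filterS (nbhs0_shift x chi_near) => y /= h.
    rewrite ltNge; apply/negP => Rey.
    have [chi_c chiD _] := dchi.
    move: h; have : nsq ((chi (y - x) - 1) * chi x) = nsq (chi (y - x) - 1).
      by rewrite nsqM (_ : nsq (chi x) = 1) ?mulr1// -circleE; apply: chi_c; exists x.
    rewrite mulrBl -chiD subrK mul1r => <-.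
    rewrite ltNge => /negP; apply; rewrite /nsq raddfB/=.
    rewrite (@le_trans _ _ ((Re (chi y) - Re (chi x)) ^+ 2))//; last by rewrite lerDl sqr_ge0.
    have := mulr_ge0 Rey (ltW (_ : 0 < - Re (chi x))); rewrite oppr_gt0 => /(_ chix).
    have := sqr_ge0 (Re (chi y)); lra.
  by move=> [y s] [/= chiy chis]; right; exists chi.
have {sP} sP x := sP s (conj Ds (fun _ => id)) x I.
exists [set x | forall chi, chi \in s -> 0 <= Re (chi x)]; split.
- elim: s Ds {sP} => [_|chi s IH Ds]; first by apply: nearW => x chi.
  have /IH Vs : D s by move=> c cs; apply: Ds; rewrite inE cs orbT.
  have := dual_Re_ge0_nbhs (Ds chi (mem_head _ _)).
  by apply: filterS2 Vs => x xs xchi c; rewrite inE => /orP[/eqP ->|/xs].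
- move=> x; rewrite /= => /existsNP[chi /not_implyP[chis /negP]].
  rewrite -ltNge => chix; exists chi; split; first exact: Ds.
    move=> _ [y Vy <-]; split; last exact: Vy.
    by have [chi_c _ _] := Ds _ chis; apply: chi_c; exists y.
  by move=> [_ /=]; rewrite leNgt chix.
- move=> x Vx; have [//|[chi /Vx]] := sP x.
  by rewrite leNgt => /negbTE ->.
Qed.

End compact_LQC.

(** * The topologies of the group of null sequences *)

Section c0_topologies.
Variable X : topologicalZmodType.
Implicit Types (x y : c0 X) (J : set (set nat)) (nu : Topological (c0 X)).

Lemma c0B x y n : (x - y) n = x n - y n.
Proof. by []. Qed.

Lemma c0D x y n : (x + y) n = x n + y n.
Proof. by []. Qed.

Lemma c00 n : (0 : c0 X) n = 0.
Proof. by []. Qed.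

Lemma c0P x y : (forall n, x n = y n) -> x = y.
Proof. by move=> xy; apply: val_inj; apply/funext. Qed.

Lemma c0_cvg x : x @ \oo --> (0 : X).
Proof. by case: x => f /= /asboolP. Qed.

Fact finseq_c0 (N : nat) (f : nat -> X) :
  (fun n => if (n < N)%N then f n else 0) \in @c0_pred X.
Proof.
apply/asboolP; apply: cvg_near_cst; exists N => // n /= Nn.
by rewrite ltnNge Nn.
Qed.

Definition finseq N f : c0 X := C0 (finseq_c0 N f).

Lemma finseqE N f n : finseq N f n = if (n < N)%N then f n else 0.
Proof. by []. Qed.

(** A common description of both topologies: closeness is required uniformly on the coordinates in
    some [S] from [J]. All of [nat] gives [u0], the initial segments give [p0]. *)
Definition seq_base nu J : Prop := forall x A, @nbhs _ (tspace nu) x A <->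
  exists2 S, J S & exists2 V, nbhs (0 : X) V & forall y, (forall n, S n -> V (y n - x n)) -> A y.

Lemma u0_base : seq_base (u0 X) [set setT].
Proof.
move=> x A; split.
  move=> [_ [[B oB <-] /= Bx BA]].
  have : nbhs (c0_val x : uniform_seq X) B by exact: open_nbhs_nbhs.
  move=> [V V0 VB]; exists setT => //; exists V => // y yx.
  by apply: BA; apply: VB => n; exact: yx.
move=> [_ -> [V V0 VA]].
have : nbhs (c0_val x : uniform_seq X) [set g | forall n, V (g n - x n)] by exists V.
move=> /(@initial_continuous (c0 X) _ (@c0_val X : c0 X -> uniform_seq X) x).
by apply: (@filterS _ (nbhs (x : tspace (u0 X)))) => y yV; apply: VA.
Qed.

Lemma p0_base : seq_base (p0 X) (range (fun N => `I_N)).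
Proof.
move=> x A; split.
  move=> [_ [[B oB <-] /= Bx BA]].
  have nB : nbhs (c0_val x : {ptws nat -> X}) B by exact: open_nbhs_nbhs.
  (* These sets restrict finitely many coordinates; the filter converges in the product topology
     because each coordinate does. *)
  pose F := filter_from [set NV : nat * set X | nbhs (0 : X) NV.2]
    (fun NV => [set f : nat -> X | forall n, (n < NV.1)%N -> NV.2 (f n - x n)]).
  have FF : Filter F.
    apply: filter_from_filter; first by exists (0%N, setT); exact: filterT.
    move=> [N V] [M W] /= V0 W0; exists (maxn N M, V `&` W); first exact: filterI.
    by move=> f /= fVW; split=> n nN; case: (fVW n); rewrite // leq_max nN ?orbT.
  have Fx : F --> (c0_val x : {ptws nat -> X}).
    apply/cvg_sup => i; apply/cvg_image.
      apply/seteqP; split=> // z _; exists (fun=> z) => //.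
    move=> C Ci; rewrite nbhs_simpl/=; exists [set f : nat -> X | C (f i)].
      exists (i.+1, [set u | C (x i + u)]); first exact: nbhs_shift0.
      by move=> f /(_ i (ltnSn i)) /=; rewrite addrC subrK.
    apply/seteqP; split=> [z [f fC <-]//|z Cz].
    by exists (fun=> z).
  have [[N V] /= V0 VB] := Fx _ nB.
  by exists `I_N; [exists N|exists V => // y yV; apply: BA; apply: VB].
move=> [_ [N _ <-] [V V0 VA]].
have coord n : nbhs (x : tspace (p0 X)) [set y : c0 X | V (y n - x n)].
  have xn := nbhs0_shift (x n) V0.
  exact: (@initial_continuous (c0 X) _ (@c0_val X : c0 X -> {ptws nat -> X}) x _
    (@proj_continuous nat (fun=> X) n (c0_val x) _ xn)).
suff : nbhs (x : tspace (p0 X)) [set y : c0 X | forall n, (n < N)%N -> V (y n - x n)].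
  by apply: filterS => y yV; exact: VA.
elim: N {VA} => [|N IH]; first by apply: (@nearW _ (nbhs (x : tspace (p0 X)))) => y n.
apply: filterS2 IH (coord N) => y yV yN n; rewrite ltnS leq_eqVlt => /orP[/eqP ->//|].
exact: yV.
Qed.

Section seq_base_theory.
Variables (nu : Topological (c0 X)) (J : set (set nat)).
Hypothesis nuJ : seq_base nu J.

Lemma seq_base_group_topology : group_topology nu.
Proof.
split.
  move=> [x y] A /nuJ[S JS [V V0 VA]].
  have [W W0 WV] := nbhs0_splitD V0.
  exists ([set x' : c0 X | forall n, S n -> W (x' n - x n)],
    [set y' : c0 X | forall n, S n -> W (y' n - y n)]).
    by split; apply/nuJ; exists S => //; exists W.
  move=> [x' y'] /= [xW yW]; apply: VA => n Sn.
  rewrite !c0D opprD addrACA; apply: WV; [exact: xW|exact: yW].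
move=> x A /nuJ[S JS [V V0 VA]]; apply/nuJ; exists S => //.
exists [set u | V (- u)]; first exact: nbhs0N.
move=> y yV; apply: VA => n /yV /=; rewrite opprB => xyV.
by have : V (- (y : c0 X) n - - (x : c0 X) n) by rewrite opprK addrC.
Qed.

Definition single n (u : X) : c0 X := finseq n.+1 (fun m => if m == n then u else 0).

Lemma singleE n u m : single n u m = if m == n then u else 0.
Proof. by rewrite finseqE; case: eqP => [->|_]; rewrite ?ltnSn// if_same. Qed.

Lemma single_continuous b n : continuous (fun u => b + single n u : tspace nu).
Proof.
move=> u A /nuJ[S JS [V V0 VA]].
apply: filterS (nbhs0_shift u V0) => v Vvu; apply: VA => m Sm.
rewrite !c0D opprD addrACA subrr add0r !singleE; case: eqP => // _.
by rewrite subrr; exact: nbhs_singleton.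
Qed.

Lemma coordinate_dual (R : realType) n (chi : X -> R[i]) :
  (exists2 S, J S & S n) -> dual R (Topological.class X) chi ->
  dual R nu (fun x => chi (x n)).
Proof.
move=> [S JS Sn] dchi; have [chi_circle chiD _] := dchi.
apply: near1_dual; first exact: seq_base_group_topology.
- by move=> x; apply: chi_circle; exists (x n).
- by move=> x y; rewrite c0D chiD.
move=> e e0; have := dual_near1 dchi e0 => H.
apply/nuJ; exists S => //; exists [set t | nsq (chi t - 1) < e]; first exact: H.
by move=> y /(_ n Sn) /=; rewrite subr0.
Qed.

End seq_base_theory.

(** For quasi-convex [W], a sequence with some term outside [W] is separated by a character of that
    single coordinate. *)
Lemma u0_locally_quasi_convex (R : realType) :
  (forall U : set X, nbhs 0 U -> exists V : set X,
    [/\ nbhs 0 V, quasi_convex R (Topological.class X) V & V `<=` U]) ->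
  locally_quasi_convex R (u0 X).
Proof.
move=> X_lqc U /u0_base[_ -> [V /X_lqc[W [W0 Wqc WV]] VU]].
exists [set x : c0 X | forall n, W (x n)]; split.
- by apply/u0_base; exists setT => //; exists W => // y yW n; have := yW n I; rewrite c00 subr0.
- move=> x /existsNP[n /Wqc[chi [dchi chiW chix]]]; exists (fun x => chi (x n)).
  split=> //; first by apply: (coordinate_dual u0_base) => //; exists setT.
  by move=> _ [y Wy <-]; apply: chiW; exists (y n).
- by move=> x xW; apply: VU => n _; rewrite c00 subr0; exact/WV/xW.
Qed.

(** A nonempty clopen set is stable under changing one coordinate, because its trace on each
    coordinate axis is clopen in [X]. Hence it is stable under changing finitely many coordinates,
    which makes it dense. *)
Lemma p0_connected : connected [set: X] -> connected [set: tspace (p0 X)].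
Proof.
move=> cX B [b Bb] [C oC]; rewrite setTI => BC [D cD]; rewrite setTI => BD.
have update c n u : B c -> B (c + single n u).
  move=> Bc; have sc := @single_continuous _ _ p0_base c n.
  have : (fun u => c + single n u : tspace (p0 X)) @^-1` B = setT.
    apply: cX.
    - exists 0; rewrite /preimage/=; congr B: Bc; apply: c0P => m.
      by rewrite c0D singleE if_same addr0.
    - exists ((fun u => c + single n u : tspace (p0 X)) @^-1` B); last by rewrite setTI.
      by rewrite BC; exact: (continuousP _).1.
    - exists ((fun u => c + single n u : tspace (p0 X)) @^-1` B); last by rewrite setTI.
      by rewrite BD; exact: (continuous_closedP _).1.
  by move=> /seteqP[_ /(_ u I)].
apply/seteqP; split=> // x _.
have approx N : exists2 c, B c & forall n, (n < N)%N -> c n = x n.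
  elim: N => [|N [c Bc cx]]; first by exists b.
  exists (c + single N (x N - c N)); first exact: update.
  move=> n; rewrite ltnS leq_eqVlt c0D singleE => /orP[/eqP ->|nN].
    by rewrite eqxx addrC subrK.
  by rewrite ltn_eqF// addr0 cx.
rewrite BD; apply: cD => A /p0_base[_ [N _ <-] [V V0 VA]].
have [c Bc cx] := approx N; exists c; split; first by rewrite -BD.
by apply: VA => n /= nN; rewrite cx// subrr; exact: nbhs_singleton.
Qed.

Lemma u0_group_topology : group_topology (u0 X).
Proof. exact: seq_base_group_topology u0_base. Qed.

Lemma p0_group_topology : group_topology (p0 X).
Proof. exact: seq_base_group_topology p0_base. Qed.

Lemma p0_coarser_u0 : coarser (p0 X) (u0 X).
Proof.
move=> A; rewrite !openE => oA x /oA /p0_base[S _ [V V0 VA]].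
by apply/u0_base; exists setT => //; exists V => // y yV; apply: VA => n _; exact: yV.
Qed.

Section compact_X.
Hypothesis cX : compact [set: X].

(** A [p0]-neighborhood restricts only [N] coordinates, so sequences of [N] entries from a finite
    net of [X], extended by zeros, suffice. *)
Lemma p0_totally_bounded : totally_bounded_group (p0 X).
Proof.
move=> U /p0_base[_ [N _ <-] [V V0 VU]].
have [s sP] := compact_totally_bounded cX V0.
pose F := [set finseq N (nth 0 t) | t in
  [set t : seq X | size t = N /\ {subset t <= [seq - a | a <- s]}]].
exists F.
  apply: finite_image; elim: N {VU F} => [|N IH].
    by apply: (sub_finite_set _ (finite_set1 [::])) => t [/size0nil -> _].
  apply: (sub_finite_set _ (finite_image2 cons (finite_seq [seq - a | a <- s]) IH)).
  move=> [|a t] [//= [tN] ts]; exists a; first by apply: ts; rewrite mem_head.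
  by exists t => //; split=> // b bt; apply: ts; rewrite inE bt orbT.
apply/seteqP; split=> // x _.
have /choice[a aP] : forall n, exists a, a \in s /\ V (x n + a).
  by move=> n; have [a] := sP (x n); exists a.
pose t := mkseq (fun n => - a n) N.
exists (finseq N (nth 0 t)).
  exists t => //; split=> [|b]; first by rewrite size_mkseq.
  by move=> /mapP[n _ ->]; apply: map_f; case: (aP n).
exists (x - finseq N (nth 0 t)); last by rewrite addrC subrK.
apply: VU => n /= nN; have -> : (x - finseq N (nth 0 t)) n - (0 : c0 X) n = x n + a n.
  by rewrite c00 subr0 c0B finseqE nN nth_mkseq// opprK.
by case: (aP n).
Qed.

End compact_X.

End c0_topologies.

(** * Metrics *)

Section metric_group.
Variables (R : realType) (X : topologicalZmodType) (m : Metric R X).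
Hypotheses (cX : compact [set: X]) (mX : induces m).
Let d : X -> X -> R := @mdist R (mspace m).

Let dxx x : d x x = 0. Proof. exact: (@mdistxx _ (mspace m)). Qed.
Let dC x y : d x y = d y x. Proof. exact: (@metric_sym _ (mspace m)). Qed.
Let d_triangle x y z : d x z <= d x y + d y z.
Proof. exact: (@metric_triangle _ (mspace m)). Qed.

Lemma nbhs_mdistP (x : X) (A : set X) :
  nbhs x A <-> exists2 r : R, 0 < r & forall y, d x y < r -> A y.
Proof.
rewrite -mX; split=> [/(@nbhs_ballP _ (mspace m))[r /= r0 rA]|[r r0 rA]];
  last apply/(@nbhs_ballP _ (mspace m)); exists r => //.
  by move=> y xy; apply: rA; rewrite (@ballEmdist _ (mspace m)).
by move=> y; rewrite (@ballEmdist _ (mspace m)); exact: rA.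
Qed.

Lemma mdist_continuous a : continuous (d a).
Proof.
move=> x; apply/cvgrPdist_lt => e e0; apply/nbhs_mdistP; exists e => // y xy.
rewrite (le_lt_trans _ xy)// ler_norml; apply/andP; split.
  by have := d_triangle a x y; lra.
by have := d_triangle a y x; rewrite (dC y); lra.
Qed.

Lemma induces_separated : separated_by_functions R X.
Proof.
move=> x x0; exists (d 0); first exact: mdist_continuous.
by rewrite dxx; apply: contra_neqN x0 => /eqP/(@mdist_positivity _ (mspace m)).
Qed.

Lemma mdist_bounded : exists2 B, 0 < B & forall x y, d x y <= B.
Proof.
have tb := compact_totally_bounded cX.
have [B B0 dB] := ucont_bounded tb (compact_ucont cX (mdist_continuous (a := 0))).
exists (B + B + 1); first by rewrite ltr_wpDl// addr_ge0.
move=> x y; rewrite (le_trans (d_triangle x 0 y))// (dC x).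
have := dB x; have := dB y; rewrite !ler_norml => /andP[_ ?] /andP[_ ?]; lra.
Qed.

(** The metric need not be translation invariant; compactness identifies its uniformity with that of
    the group, here and conversely in [nbhs_unif_mdist]. *)
Lemma mdist_unif_nbhs (U : set X) : nbhs 0 U ->
  exists2 r, 0 < r & forall x y, d x y < r -> U (y - x).
Proof.
move=> /nbhs0_splitB[W W0 WU].
pose P (r : R) x := forall y, d x y < r -> U (y - x).
have : \forall r \near 0^'+, [set: X] `<=` P r.
  apply: ((compact_near_coveringP _).1 cX) => x _.
  have /nbhs_mdistP[r r0 rW] := nbhs0_shift x W0.
  exists ([set y | d x y < r / 2], [set s | s < r / 2]) => /=.
    split; first by apply/nbhs_mdistP; exists (r / 2) => //; rewrite divr_gt0.
    by apply: nbhs_right_lt; rewrite divr_gt0.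
  move=> [y s] [/= xy sr] z yz.
  have -> : z - y = (z - x) - (y - x) by rewrite opprB addrA subrK.
  have := d_triangle x y z.
  by move=> xyz; apply: WU; apply: rW; lra.
have r0 : \forall r \near (0 : R)^'+, 0 < r by exact: nbhs_right_gt.
move=> rP; have [r [rU r_gt0]] := @filter_ex _ (0 : R)^'+ _ _ (filterI rP r0).
by exists r => // x y; exact: rU.
Qed.

Lemma nbhs_unif_mdist (r : R) : 0 < r ->
  exists2 U : set X, nbhs 0 U & forall x y, U (y - x) -> d x y < r.
Proof.
move=> r0; pose P (u : X) x := d x (x + u) < r.
have r20 : 0 < r / 2 by rewrite divr_gt0.
have : \forall u \near (0 : X), [set: X] `<=` P u.
  apply: ((compact_near_coveringP _).1 cX) => x _.
  have : nbhs x [set y | d x y < r / 2] by apply/nbhs_mdistP; exists (r / 2).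
  move=> /nbhs_shift0/nbhs0_splitD[V V0 VU].
  exists ([set y | V (y - x)], V); first by split=> //; exact: nbhs0_shift.
  move=> [y u] [/= Vy Vu]; rewrite /P.
  have /= := VU _ 0 Vy (nbhs_singleton V0); rewrite addr0 [x + _]addrC subrK => h1.
  have /= := VU _ _ Vy Vu; rewrite addrA [x + _]addrC subrK => h2.
  by have := d_triangle y x (y + u); rewrite (dC y x); lra.
move=> U0; exists [set u | [set: X] `<=` P u] => // x y /(_ x I).
by rewrite /P addrC subrK.
Qed.

(* The weights [1] give [u0] and the weights [1 / n.+1] give [p0]. *)
Section weighted_sup_metric.
Variables (a : nat -> R).
Hypotheses (a_gt0 : forall n, 0 < a n) (a_le1 : forall n, a n <= 1).
Implicit Types x y z : c0 X.

Definition sup_dist x y : R := sup (range (fun n => a n * d (x n) (y n))).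

Let has_sup_dist x y : has_sup (range (fun n => a n * d (x n) (y n))).
Proof.
have [B B0 dB] := mdist_bounded.
split; first by exists (a 0 * d (x 0) (y 0)), 0%N.
exists B => _ [n _ <-]; rewrite (le_trans (ler_wpM2l (ltW (a_gt0 n)) (dB _ _)))//.
by rewrite ler_piMl// ltW.
Qed.

Lemma sup_dist_ge x y n : a n * d (x n) (y n) <= sup_dist x y.
Proof. by apply: ub_le_sup; [case: (has_sup_dist x y)|exists n]. Qed.

Lemma sup_dist_le x y e : (forall n, a n * d (x n) (y n) <= e) -> sup_dist x y <= e.
Proof.
move=> xy; apply: ge_sup; first by case: (has_sup_dist x y).
by move=> _ [n _ <-].
Qed.

Lemma sup_distxx x : sup_dist x x = 0.
Proof.
apply/eqP; rewrite eq_le; apply/andP; split.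
  by apply: sup_dist_le => n; rewrite dxx mulr0.
by have := sup_dist_ge x x 0; rewrite dxx mulr0.
Qed.

Lemma sup_dist_positivity x y : sup_dist x y = 0 -> x = y.
Proof.
move=> xy0; apply: c0P => n; apply: (@mdist_positivity _ (mspace m)); apply/eqP.
rewrite eq_le (@mdist_ge0 _ (mspace m)) andbT.
by have := sup_dist_ge x y n; rewrite xy0 pmulr_rle0.
Qed.

Lemma sup_distC x y : sup_dist x y = sup_dist y x.
Proof. by rewrite /sup_dist; under eq_fun do rewrite dC. Qed.

Lemma sup_dist_triangle y x z : sup_dist x z <= sup_dist x y + sup_dist y z.
Proof.
apply: sup_dist_le => n; rewrite (le_trans (ler_wpM2l (ltW (a_gt0 n)) (d_triangle _ (y n) _)))//.
by rewrite mulrDr lerD// sup_dist_ge.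
Qed.

(** A separate name that carries the metric instance, from which the structure on [c0 X] is
    extracted. *)
Definition c0_copy : Type := c0 X.
HB.instance Definition _ := Choice.on c0_copy.
HB.instance Definition _ := @isMetric.Build R c0_copy sup_dist sup_distxx
  sup_dist_positivity sup_distC sup_dist_triangle.

Definition sup_metric : Metric R (c0 X) := Metric.class c0_copy.

Lemma sup_metricE x e : @ball R (mspace sup_metric) x e = [set y | sup_dist x y < e].
Proof. by []. Qed.

(** Weights bounded below on [S] turn small distances into closeness there; small weights off [S],
    with [d] bounded, make the other coordinates negligible. *)
Lemma sup_metric_induces nu J : seq_base nu J ->
  (forall S, J S -> exists2 b, 0 < b & forall n, S n -> b <= a n) ->
  (forall e, 0 < e -> exists2 S, J S & forall n, ~ S n -> a n <= e) ->
  @induces R (tspace nu) sup_metric.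
Proof.
move=> nuJ J_lb J_ub x; apply/seteqP; split=> A.
  move=> /(@nbhs_ballP _ (mspace sup_metric))[e /= e0 eA].
  have [B B0 dB] := mdist_bounded.
  have e20 : 0 < e / 2 by rewrite divr_gt0.
  have [S JS aS] := J_ub (e / 2 / B) (divr_gt0 e20 B0).
  have [U U0 Ud] := nbhs_unif_mdist e20.
  apply/nuJ; exists S => //; exists U => // y yU; apply: eA; rewrite sup_metricE/=.
  suff : sup_dist x y <= e / 2 by lra.
  apply: sup_dist_le => n; have dn0 := @mdist_ge0 _ (mspace m) (x n) (y n).
  have [Sn|nSn] := pselect (S n).
    by rewrite (le_trans _ (ltW (Ud _ _ (yU n Sn))))// ler_piMl.
  rewrite (@le_trans _ _ (e / 2 / B * B))//; last by rewrite divfK// lt0r_neq0.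
  by rewrite ler_pM// ?(ltW (a_gt0 n))// aS.
move=> /nuJ[S JS [V V0 VA]]; have [b b0 bS] := J_lb S JS.
have [r r0 rV] := mdist_unif_nbhs V0.
apply/(@nbhs_ballP _ (mspace sup_metric)); exists (b * r); first exact: mulr_gt0.
move=> y; rewrite sup_metricE/= => xy; apply: VA => n Sn; apply: rV.
rewrite -(ltr_pM2l b0) (le_lt_trans _ xy)// (le_trans _ (sup_dist_ge x y n))//.
by rewrite ler_wpM2r ?(@mdist_ge0 _ (mspace m))// bS.
Qed.

End weighted_sup_metric.

Lemma p0_metrizable : metrizable R (tspace (p0 X)).
Proof.
have inv_gt0 n : 0 < n.+1%:R^-1 :> R by rewrite invr_gt0.
have inv_le1 n : n.+1%:R^-1 <= 1 :> R by rewrite invf_le1// ler1n.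
exists (sup_metric inv_gt0 inv_le1).
apply: (sup_metric_induces _ _ (@p0_base X)) => [_ [N _ <-]|e e0].
  exists N.+1%:R^-1 => // n /= nN.
  by rewrite lef_pV2 ?posrE// ler_nat ltnS ltnW.
exists `I_(Num.truncn e^-1).+1; first by exists (Num.truncn e^-1).+1.
move=> n /= /negP; rewrite -leqNgt => en.
rewrite -[leRHS]invrK lef_pV2 ?posrE ?invr_gt0//.
rewrite (le_trans (ltW (truncnS_gt _)))// ler_nat (leq_trans en)//.
Qed.

Let one_gt0 (n : nat) : 0 < (fun=> 1 : R) n. Proof. exact: ltr01. Qed.
Let one_le1 (n : nat) : (fun=> 1 : R) n <= 1. Proof. exact: lexx. Qed.

Lemma u0_metric_induces : @induces R (tspace (u0 X)) (sup_metric one_gt0 one_le1).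
Proof.
apply: (sup_metric_induces _ _ (@u0_base X)) => [_ ->|e e0]; first by exists 1.
by exists setT => // n [].
Qed.

(** Compactness gives a cluster point, and a Cauchy filter converges to its cluster points. *)
Lemma metric_compact_complete (F : set_system X) : ProperFilter F ->
  (forall e, 0 < e -> exists x, F [set y | d x y < e]) ->
  exists l, forall e, 0 < e -> F [set y | d l y < e].
Proof.
move=> PF Fcauchy; have [l [_ cl]] := cX PF filterT.
exists l => e e0; have e30 : 0 < e / 3 by rewrite divr_gt0.
have [x Fx] := Fcauchy _ e30.
have nl : nbhs l [set y | d l y < e / 3] by apply/nbhs_mdistP; exists (e / 3).
have [y [/= xy ly]] := cl _ _ Fx nl.
apply: filterS Fx => z /= xz.
by have := d_triangle l y z; have := d_triangle y x z; rewrite (dC y x); lra.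
Qed.

Let sup1_dist (x y : c0 X) n : d (x n) (y n) <= sup_dist (fun=> 1) x y.
Proof. by rewrite -[leLHS]mul1r; exact: (sup_dist_ge one_gt0 one_le1). Qed.

Let sup1_dist_le (x y : c0 X) e : (forall n, d (x n) (y n) <= e) -> sup_dist (fun=> 1) x y <= e.
Proof. by move=> xy; apply: (sup_dist_le one_gt0 one_le1) => n; rewrite mul1r. Qed.

(** Coordinatewise limits exist in [X]. The Cauchy estimate is uniform in the coordinate, so the
    limit is uniformly close to null sequences and hence null, and convergence holds for the
    supremum. *)
Lemma u0_complete : complete_metric (sup_metric one_gt0 one_le1).
Proof.
move=> F PF /cauchyP Fcauchy.
have Fex (e : R) : 0 < e -> exists x : c0 X, F [set y | sup_dist (fun=> 1) x y < e].
  exact: Fcauchy.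
have /choice[l lP] : forall n, exists l, forall e : R, 0 < e -> F [set y : c0 X | d l (y n) < e].
  move=> n; have [|l lP] := @metric_compact_complete ((fun y : c0 X => y n) @ F) _.
    move=> e /Fex[x xF]; exists (x n); apply: (@filterS _ F _ _ _ _ xF) => y /=.
    exact/le_lt_trans/sup1_dist.
  by exists l.
have lx e (x : c0 X) : F [set y : c0 X | sup_dist (fun=> 1) x y < e] ->
    forall n, d (x n) (l n) <= e.
  move=> Fx n; apply/ler_addgt0Pl => h h0.
  have [y [/= xy ly]] := filter_ex (filterI Fx (lP n h h0)).
  by have := d_triangle (x n) (y n) (l n); have := sup1_dist x y n; rewrite (dC (y n)); lra.
have l0 : l \in @c0_pred X.
  apply/asboolP => U U0; have [V V0 VU] := nbhs0_splitD U0.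
  have [r r0 rV] := mdist_unif_nbhs V0.
  have [x Fx] := Fex (r / 2) (divr_gt0 r0 (ltr0n _ 2)).
  have [N _ NV] := c0_cvg x V0; exists N => // n /NV /= Vx.
  have -> : l n = x n + (l n - x n) by rewrite addrC subrK.
  by apply: VU => //; apply: rV; rewrite (le_lt_trans (lx _ _ Fx n))//; lra.
exists (C0 l0) => A /(@nbhs_ballP _ (mspace (sup_metric one_gt0 one_le1)))[e /= e0 eA].
have [x Fx] := Fex (e / 3) (divr_gt0 e0 (ltr0n _ 3)).
apply: filterS (Fx) => y xy; apply: eA; rewrite sup_metricE/=.
have le3 : sup_dist (fun=> 1) (C0 l0) x <= e / 3.
  by apply: sup1_dist_le => n /=; rewrite dC; exact: lx.
have := sup_dist_triangle one_gt0 one_le1 x (C0 l0) y; move: xy => /=; lra.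
Qed.

Lemma dense_sequence : exists q : nat -> X, forall x U, nbhs (0 : X) U -> exists j, U (x - q j).
Proof.
have /choice[s sP] : forall k, exists s : seq X,
    forall x, exists2 a, a \in s & d 0 (x + a) < k.+1%:R^-1.
  move=> k; apply: (compact_totally_bounded cX (U := [set x | d 0 x < k.+1%:R^-1])).
  by apply/nbhs_mdistP; exists k.+1%:R^-1 => //; rewrite invr_gt0.
(* All entries of the finite nets for the radii [k.+1%:R^-1], negated because a net makes [x + a]
   small; codes of no pair get the default [0]. *)
exists (fun j => if unpickle j is Some (k, i) then - nth 0 (s k) i else 0) => x U.
move=> /nbhs_mdistP[r r0 rU]; pose k := Num.truncn r^-1.
have [a as_ xa] := sP k x; exists (pickle (k, index a (s k))).
rewrite pickleK nth_index// opprK; apply: rU; rewrite (lt_trans xa)//.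
by rewrite -[ltRHS]invrK ltf_pV2 ?posrE ?invr_gt0// truncnS_gt.
Qed.

(** Null sequences are uniformly close to their truncations, and the remaining finitely many entries
    can be taken from a dense sequence. *)
Lemma u0_separable : Defs.separable (tspace (u0 X)).
Proof.
have [q qP] := dense_sequence.
pose g (s : seq nat) := finseq (size s) (fun n => q (nth 0%N s n)).
exists (range g); first exact: card_le_trans (card_image_le _ _) (countableP _).
move=> O [x Ox] oO; have /u0_base[_ -> [U U0 UO]] := open_nbhs_nbhs (conj oO Ox).
have [V V0 VU] := nbhs0_splitB U0.
have [N _ NV] := c0_cvg x V0.
have /choice[j jP] : forall n, exists j, U (- (x n - q j)) by move=> n; exact: qP (nbhs0N U0).
pose s := mkseq j N; exists (g s); split; last by exists s.
apply: UO => n _; rewrite finseqE size_mkseq; case: ltnP => nN.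
  by rewrite nth_mkseq// -opprB.
by apply: VU; [exact: nbhs_singleton|exact: NV].
Qed.

Lemma u0_polish : polish R (tspace (u0 X)).
Proof.
by split; [exact: u0_separable|exists (sup_metric one_gt0 one_le1);
  [exact: u0_metric_induces|exact: u0_complete]].
Qed.

Lemma metrizable_hausdorff (T : topologicalType) : metrizable R T -> hausdorff_space T.
Proof.
move=> [m' indm] p q pq; apply: (@metric_hausdorff _ (mspace m')).
by move=> A B; rewrite !indm; exact: pq.
Qed.

End metric_group.

(** * Characters of the group of null sequences *)

Section dual_of_c0.
Variables (R : realType) (X : topologicalZmodType).
Hypotheses (cX : compact [set: X]) (connX : connected [set: X]).
Local Open Scope complex_scope.
Local Notation Re := complex.Re.

(** The finite sums of elements of [W] form a nonempty clopen set, hence all of [X]; compactness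
    then bounds the number of summands. *)
Lemma connected_sums (W : set X) : nbhs 0 W ->
  exists k, forall x, exists t : seq X,
    [/\ (size t <= k)%N, {in t, forall a, W a} & x = \sum_(a <- t) a].
Proof.
move=> W0; pose P k x := exists t : seq X,
  [/\ (size t <= k)%N, {in t, forall a, W a} & x = \sum_(a <- t) a].
have P_step k x u : P k x -> W u -> P k.+1 (x + u).
  move=> [t [tk tW ->]] Wu; exists (u :: t); split=> // [a|].
    by rewrite inE => /orP[/eqP ->|/tW].
  by rewrite big_cons addrC.
have P_mono k l x : (k <= l)%N -> P k x -> P l x.
  by move=> kl [t [tk tW ->]]; exists t; split=> //; exact: leq_trans kl.
pose H := [set x | exists k, P k x].
have HT : H = setT.
  apply: connX.
  - by exists 0, 0%N, [::]; split=> //; rewrite big_nil.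
  - exists H; last by rewrite setTI.
    rewrite openE => x [k Px]; apply: filterS (nbhs0_shift x W0) => y Wyx.
    by exists k.+1; rewrite -[y](subrK x) addrC; exact: P_step.
  - exists H; last by rewrite setTI.
    (* [W] need not be symmetric, so closure points are tested against [x - W]. *)
    move=> x clx; have [y [[k Py] Wxy]] := clx _ (nbhs0_shift x (nbhs0N W0)).
    exists k.+1; rewrite -[x](subrK y) addrC; apply: P_step => //.
    by move: Wxy; rewrite /= opprB.
have [k _ kP] : \forall k \near \oo, [set: X] `<=` P k.
  apply: ((compact_near_coveringP _).1 cX) => x _.
  have [k Px] : H x by rewrite HT.
  exists ([set y | W (y - x)], [set l | (k.+1 <= l)%N]).
    by split=> /=; [exact: nbhs0_shift|exists k.+1].
  move=> [y l] [/= Wyx kl]; apply: (P_mono k.+1) => //.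
  by rewrite -[y](subrK x) addrC; exact: P_step.
by exists k => x; apply: (kP k) => /=.
Qed.

Variable chi : c0 X -> R[i].
Hypothesis dchi : dual R (u0 X) chi.

Let chiD x y : chi (x + y) = chi x * chi y. Proof. by case: dchi. Qed.

Let chi_nsq x : nsq (chi x) = 1.
Proof. by case: dchi => chi_c _ _; rewrite -circleE; apply: chi_c; exists x. Qed.

Let chi0 : chi 0 = 1.
Proof.
by apply: (mulIf (nsq1_neq0 (chi_nsq 0))); rewrite -chiD mul1r addr0.
Qed.

Let nsq_sub1 (z : R[i]) : nsq z = 1 -> nsq (z - 1) = 2 - 2 * Re z.
Proof. by case: z => a b; rewrite /nsq/= subr0 => z1; lra. Qed.

Let chi_near e : 0 < e -> exists2 V, nbhs (0 : X) V &
  forall y : c0 X, (forall n, V (y n)) -> nsq (chi y - 1) < e.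
Proof.
move=> e0; have /u0_base[_ -> [V V0 VP]] := dual_near1 dchi e0.
by exists V => // y yV; apply: VP => n _; rewrite /= subr0.
Qed.

Let singleD n u v : single n (u + v) = single n u + single n v :> c0 X.
Proof. by apply: c0P => m; rewrite c0D !singleE; case: eqP; rewrite ?addr0. Qed.

Let single0 n : single n 0 = 0 :> c0 X.
Proof. by apply: c0P => m; rewrite singleE if_same. Qed.

Let chi_singleX n u m : chi (single n (u *+ m)) = chi (single n u) ^+ m.
Proof.
elim: m => [|m IH]; first by rewrite mulr0n single0 chi0.
by rewrite mulrS singleD chiD IH exprS.
Qed.

(* Connectedness enters here: finitely many steps inside [W] reach any point, so a
   nontrivial coordinate character moves some point of [W] by a fixed amount. *)
Lemma coordinate_character_gap (W : set X) : nbhs 0 W -> exists2 d, 0 < d &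
  forall n, (exists u, chi (single n u) != 1) ->
  exists2 w, W w & d < nsq (chi (single n w) - 1).
Proof.
(* By [nsqD], each summand multiplies the bound by at most 4, so [k] small steps stay within 1,
   whereas a negative real part forces a value above 2. *)
move=> /connected_sums[k kP]; pose d : R := (4 ^+ k)^-1.
have d0 : 0 < d by rewrite invr_gt0 exprn_gt0.
exists d => // n [u un1]; have [m Rem] := circle_no_small_subgroup (chi_nsq _) un1.
apply: contrapT => noW.
have small a : W a -> nsq (chi (single n a) - 1) <= d.
  by move=> Wa; rewrite leNgt; apply/negP => ?; apply: noW; exists a.
have sums (t : seq X) : {in t, forall a, W a} ->
    nsq (chi (single n (\sum_(a <- t) a)) - 1) <= 4 ^+ size t * d.
  elim: t => [_|a t IH tW].
    by rewrite big_nil single0 chi0 subrr /nsq/= expr0n addr0 mulr_ge0// ltW.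
  have /IH IHt : {in t, forall a, W a} by move=> b bt; apply: tW; rewrite inE bt orbT.
  rewrite big_cons singleD chiD; set z := chi _; set y := chi _ in IHt *.
  have -> : z * y - 1 = (z - 1) * y + (y - 1) by ring.
  rewrite (le_trans (nsqD _ _))// nsqM chi_nsq mulr1.
  have zd : nsq (z - 1) <= d by apply: small; apply: tW; rewrite mem_head.
  have p1 : 1 <= 4 ^+ size t :> R by rewrite exprn_ege1// ler1n.
  have := ler_wpM2r (ltW d0) p1; rewrite /= exprS mul1r; lra.
have [t [tk tW ut]] := kP (u *+ m).
have := sums t tW; rewrite -ut chi_singleX nsq_sub1; last by rewrite -chi_singleX chi_nsq.
have : 4 ^+ size t * d <= 1 :> R.
  by rewrite /d ler_pdivrMr ?exprn_gt0// mul1r ler_weXn2l// ler1n.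
by move: Rem; lra.
Qed.

Lemma u0_character_finite_support : exists N, forall n u, (N <= n)%N -> chi (single n u) = 1.
Proof.
have [V V0 VP] := chi_near (@ltr01 R).
(* Symmetric, so that the sign of each chosen entry is free. *)
pose W := [set u | V u /\ V (- u)].
have W0 : nbhs 0 W by apply: filterI V0 (nbhs0N V0).
have [d d0 gap] := coordinate_character_gap W0.
have Re_half (y : c0 X) : (forall n, W (y n)) -> 1 / 2 < Re (chi y).
  move=> yW; have := VP y (fun n => (yW n).1); rewrite nsq_sub1//; lra.
apply: contrapT => /forallNP nontriv.
have nontrivial M : exists n, (M <= n)%N /\ exists u, chi (single n u) != 1.
  apply: contrapT => triv; apply: (nontriv M) => n u Mn; apply/eqP/negPn/negP => un1.
  by apply: triv; exists n; split=> //; exists u.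
(* A gap [d < 2 - 2 * Re s] means that [Re s] is below [1 - d / 2]; the maximum keeps [r]
   nonnegative. *)
pose r := Num.max 0 (1 - d / 2).
have r0 : 0 <= r by rewrite le_max lexx.
have r1 : r < 1 by rewrite gt_max ltr01/=; lra.
have W00 : W 0 by rewrite /W/= oppr0; split; exact: nbhs_singleton.
have decay m : exists M (y : c0 X), [/\ forall n, (M <= n)%N -> y n = 0,
    forall n, W (y n) & Re (chi y) <= r ^+ m].
  elim: m => [|m [M [y [yM yW yr]]]].
    by exists 0%N, 0; split=> //; rewrite chi0 expr0.
  have [n [Mn /gap[w Ww dw]]] := nontrivial M.
  set s := chi (single n w) in dw.
  have sr : Re s <= r.
    by move: dw; rewrite nsq_sub1 ?chi_nsq// /r le_max => ?; apply/orP; right; lra.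
  have chiV : chi (single n (- w)) = (s^*)%C.
    apply: (mulIf (nsq1_neq0 (chi_nsq _ : nsq s = 1))); rewrite -chiD -singleD addNr single0 chi0.
    have := chi_nsq (single n w); rewrite -/s; case: (s) => a b; rewrite /nsq/= => ab.
    apply/eqP; rewrite eq_complex/=; apply/andP; split; apply/eqP; last by ring.
    by rewrite -[LHS]ab; ring.
  have step w' : W w' -> Re (chi y * chi (single n w')) <= r ^+ m.+1 ->
      exists M' (y' : c0 X), [/\ forall n, (M' <= n)%N -> y' n = 0,
      forall n, W (y' n) & Re (chi y') <= r ^+ m.+1].
    move=> Ww' le_r; exists n.+1, (y + single n w'); split=> [l nl|l|].
    - by rewrite c0D singleE gtn_eqF// addr0 yM// (leq_trans Mn)// ltnW.
    - rewrite c0D singleE; case: eqP => [->|_]; last by rewrite addr0.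
      by rewrite yM// add0r.
    - by rewrite chiD.
  have Ry := Re_half y yW.
  (* The two real parts have average [Re (chi y) * Re s], which is at most [r ^+ m.+1], so one of
     them is as well. *)
  have key : Re (chi y * s) <= r ^+ m.+1 \/ Re (chi y * (s^*)%C) <= r ^+ m.+1.
    have h1 : Re (chi y) * Re s <= r ^+ m.+1.
      rewrite exprSr (le_trans (ler_wpM2l _ sr))//; first by lra.
      exact: ler_wpM2r.
    case: (leP (Re (chi y * s)) (r ^+ m.+1)) => [?|h2]; [by left|right].
    by move: h1 h2; case: (chi y) (s) => a b [c e]/=; lra.
  case: key => h; first by apply: (step w).
  apply: (step (- w)); last by rewrite chiV.
  by move: Ww; rewrite /W/= opprK => -[].
have := cvg_expr (_ : `|r| < 1); rewrite ger0_norm// => /(_ r1).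
move=> /cvgrPdist_lt/(_ (1 / 2)) [|m _ /(_ m (leqnn m))]; first lra.
rewrite /= sub0r normrN ger0_norm ?exprn_ge0//.
have [M [y [_ yW]]] := decay m; have := Re_half y yW; lra.
Qed.

(** The truncations of a null sequence converge to it in [u0], and from length [N] on they have the
    same character value. So the first [N] coordinates determine [chi]. *)
Lemma u0_character_p0_continuous : dual R (p0 X) chi.
Proof.
have [N trivN] := u0_character_finite_support.
have chi_tail M (f : nat -> X) : chi (finseq (N + M) f) = chi (finseq N f).
  elim: M => [|M IH]; first by rewrite addn0.
  rewrite -IH addnS; have -> : finseq (N + M).+1 f =
      finseq (N + M) f + single (N + M) (f (N + M)%N).
    apply: c0P => n; rewrite c0D singleE !finseqE ltnS leq_eqVlt.
    by case: eqP => [->|_]; rewrite ?ltnn ?add0r ?addr0.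
  by rewrite chiD trivN ?leq_addr// mulr1.
have chi_trunc (x : c0 X) : chi x = chi (finseq N x).
  apply/eqP; rewrite -subr_eq0; apply/eqP/nsq_le0/ler_addgt0Pl => e e0.
  have [V V0 VP] := chi_near e0; have [M _ MV] := c0_cvg x V0.
  rewrite addr0 -(chi_tail M).
  have -> : chi x - chi (finseq (N + M) x) =
      (chi (x - finseq (N + M) x) - 1) * chi (finseq (N + M) x).
    by rewrite mulrBl -chiD subrK mul1r.
  rewrite nsqM chi_nsq mulr1 ltW// VP// => n; rewrite c0B finseqE.
  case: ltnP => [_|nM]; first by rewrite subrr; exact: nbhs_singleton.
  by rewrite subr0; apply: MV => /=; rewrite (leq_trans _ nM)// leq_addl.
apply: near1_dual; first exact: p0_group_topology.
- by move=> x; rewrite circleE.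
- exact: chiD.
move=> e e0; have [V V0 VP] := chi_near e0.
apply/p0_base; exists `I_N; first by exists N.
exists V => // y yV /=; rewrite chi_trunc; apply: VP => n; rewrite finseqE.
case: ltnP => nN; last exact: nbhs_singleton.
by have := yV n nN; rewrite /= subr0.
Qed.

End dual_of_c0.

Lemma dual_coarser (R : realType) (G : zmodType) (mu nu : Topological G) :
  coarser mu nu -> dual R mu `<=` dual R nu.
Proof.
move=> munu chi [chi_c chiD /continuousP chi_cont]; split=> //.
by apply/continuousP => A oA; apply: munu; exact: chi_cont.
Qed.

Theorem theorem7p5 (R : realType) (X : topologicalZmodType)
    (X_infinite : infinite_set [set: X])
    (X_compact : compact [set: X])
    (X_connected : connected [set: X])
    (X_metrizable : metrizable R X) :
  (* (a) *)
  dual R (p0 X) = dual R (u0 X) /\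
  (* (b) *)
  [/\ group_topology (u0 X), locally_quasi_convex R (u0 X),
      polish R (tspace (u0 X)) & compatible R (p0 X) (u0 X)] /\
  (* (c) *)
  [/\ group_topology (p0 X), totally_bounded_group (p0 X),
      metrizable R (tspace (p0 X)), ~ mackey_in_LQC R (p0 X) &
      connected [set: tspace (p0 X)]].
Proof.
case: (X_metrizable) => m mX.
have dual_eq : dual R (p0 X) = dual R (u0 X).
  apply/seteqP; split; first exact/dual_coarser/p0_coarser_u0.
  by move=> chi; exact: u0_character_p0_continuous.
have X_lqc := compact_quasi_convex_basis X_compact (induces_separated mX).
have u0_lqc := u0_locally_quasi_convex X_lqc.
have u0_pol := u0_polish X_compact mX.
have u0_comp : compatible R (p0 X) (u0 X) by split; [exact: u0_group_topology|].
split=> //; split; split=> //.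
- exact: u0_group_topology.
- exact: p0_group_topology.
- exact: p0_totally_bounded.
- exact: p0_metrizable X_compact mX.
(* The competing topology is [u0]: were [p0] Mackey, every [u0]-open set would be [p0]-open. *)
- move=> [_ /(_ (u0 X) u0_comp)].
  have u0_haus : hausdorff_space (tspace (u0 X)).
    by apply: (@metrizable_hausdorff R); case: u0_pol => _ [m' m'u _]; exists m'.
  move=> /(_ (And3 (u0_group_topology X) u0_haus u0_lqc)) u0p0.
  have [y y0] : exists y : X, y != 0.
    apply: contrapT => /forallNP X0; apply: X_infinite.
    apply: (sub_finite_set _ (finite_set1 (0 : X))) => x _ /=.
    by apply/eqP/negPn/negP/X0.
  have [V V0 Vy] : exists2 V, nbhs (0 : X) V & ~ V y.
    have [f fc fy] := induces_separated mX y0.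
    have e0 : 0 < `|f y - f 0| by rewrite normr_gt0 subr_eq0.
    have /cvgrPdist_lt/(_ _ e0) f0 := fc 0.
    exists [set z | `|f 0 - f z| < `|f y - f 0|]; first exact: f0.
    by rewrite /= distrC ltxx.
  have : @nbhs _ (tspace (u0 X)) 0 [set x : c0 X | forall n, V (x n)].
    apply/u0_base; exists setT => //; exists V => // x xV n.
    by have := xV n I; rewrite /= subr0.
  rewrite (@nbhsE (tspace (u0 X))) => -[B [oB B0] BV].
  have /p0_base[_ [N _ <-] [W W0 WB]] : @nbhs _ (tspace (p0 X)) 0 B.
    by apply: open_nbhs_nbhs; split=> //; exact: u0p0.
  (* Coordinate [N] is the first one that the [p0]-neighborhood leaves free; placing [y] there
     contradicts the uniform restriction to [V]. *)
  apply: Vy; have /BV/(_ N) : B (single N y); last by rewrite singleE eqxx.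
  apply: WB => n nN; have -> : single N y n - (0 : c0 X) n = 0.
    by rewrite c00 subr0 singleE ltn_eqF.
  exact: nbhs_singleton.
- exact: p0_connected.
Qed.
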